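(* Let $G$ be a Lie group with Lie algebra $\mathfrak g$ and let $\alpha\colon\mathbb R\to\mathrm{Aut}(G)$ define an $\mathbb R$-action on $G$ such that the following hold. (L1) $G$ is a Lie group modeled on a locally convex space. (L2) $\alpha$ is smooth, so that $G^\flat=G\rtimes_\alpha\mathbb R$ is a Lie group; let $\alpha^{\mathfrak g}_t=\mathrm{Lie}(\alpha_t)\in\mathrm{Aut}(\mathfrak g)$ and $D=\frac{d}{dt}\big|_{t=0}\alpha^{\mathfrak g}_t\in\mathrm{der}(\mathfrak g)$. (L3) The fixed point group $G^0=\{g\in G:\alpha_t(g)=g\ \forall t\in\mathbb R\}$ is a Lie group with Lie algebra $\mathfrak g^0=\{x\in\mathfrak g:\alpha_t^{\mathfrak g}x=x\ \forall t\in\mathbb R\}$. (L4) The subspace $\mathfrak g_+=\overline{D(\mathfrak g)}$ complements $\mathfrak g^0$, in the sense that $\mathfrak g=\mathfrak g^0\oplus\mathfrak g_+$ as topological vector spaces; let $p_0\colon\mathfrak g\to\mathfrak g^0$ be the continuous projection with kernel $\mathfrak g_+$. If $(\pi,\mathcal H)$ is a smooth ground state representation of $(G,\alpha)$, and $(\pi^0,\mathcal H^0)$ is the corresponding representation of $G^0$ on the minimal energy space, then the closed convex cone $C_\alpha=\overline{\mathrm{conv}}\{p_0([Dx,x]):x\in\mathfrak g\}\subseteq\mathfrak g^0$ satisfies $$C_\alpha\subseteq C_{\pi^0}:=\{x\in\mathfrak g^0:\ -i\,\partial\pi^0(x)\ge 0\}.$$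
   Context: Unitary representations are strongly continuous representations on complex Hilbert spaces. Lie groups are assumed to have a smooth exponential function $\exp$. For a unitary representation $(\pi,\mathcal H)$ of a Lie group and $x$ in its Lie algebra, $\partial\pi(x)$ is the skew-adjoint infinitesimal generator of the unitary one-parameter group $t\mapsto\pi(\exp tx)$, i.e. $\pi(\exp tx)=e^{t\partial\pi(x)}$. A vector $\xi\in\mathcal H$ is smooth if $g\mapsto\pi(g)\xi$ is smooth on $G$; $\mathcal H^\infty$ is the space of smooth vectors for $G$. A positive energy representation of $(G,\alpha)$ is a triple $(\pi,U,\mathcal H)$ with $(\pi,\mathcal H)$ a unitary representation of $G$ and $U_t=e^{itH}$ a strongly continuous unitary one-parameter group with $H=H^*\ge0$ and $U_t\pi(g)U_{-t}=\pi(\alpha_t(g))$ for all $t\in\mathbb R,\ g\in G$. Its minimal energy space is $\mathcal H^0=\ker H$; it is invariant under $\pi(G^0)$, and $\pi^0(g)=\pi(g)|_{\mathcal H^0}$ for $g\in G^0$. It is a ground state representation if $\pi(G)\mathcal H^0$ spans a dense subspace of $\mathcal H$. (In this case $U$ is determined by $\pi$, so one also calls $(\pi,\mathcal H)$ a ground state representation.) A ground state representation is called smooth if $\mathcal H^0\cap\mathcal H^\infty$ is dense in $\mathcal H^0$. *)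

(* Defs.v *)
From HB Require Import structures.
From mathcomp Require Import all_boot all_order all_algebra.
From mathcomp Require Import sesquilinear.
From mathcomp Require Import complex.
From mathcomp Require Import boolp classical_sets reals interval_inference.
From mathcomp Require Import convex topology normedtype.

Set Implicit Arguments.
Unset Strict Implicit.
Unset Printing Implicit Defensive.

Import Order.TTheory GRing.Theory Num.Theory.
Import numFieldNormedType.Exports.

Local Open Scope classical_set_scope.
Local Open Scope ring_scope.

(* The real locally convex space underlying a complex one; needed to speak
   about smooth maps with values in a complex Hilbert space. *)
Definition realify (R : realType) (V : tvsType R[i]) : Type := V.

Section Realify.
Variables (R : realType) (V : tvsType R[i]).
Local Notation W := (realify V).

HB.instance Definition _ := Uniform.on W.
HB.instance Definition _ := GRing.Zmodule.on W.

Let rscale (t : R) (v : W) : W := (t%:C%C : R[i]) *: (v : V).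

Let rscaleA a b v : rscale a (rscale b v) = rscale (a * b) v.
Proof. by rewrite /rscale scalerA -rmorphM. Qed.
Let rscale1 : left_id 1 rscale.
Proof. by move=> v; rewrite /rscale rmorph1 scale1r. Qed.
Let rscaleDr : right_distributive rscale +%R.
Proof. by move=> a u v; rewrite /rscale scalerDr. Qed.
Let rscaleDl v : {morph rscale^~ v : a b / a + b}.
Proof. by move=> a b; rewrite /rscale rmorphD scalerDl. Qed.

HB.instance Definition _ := GRing.Zmodule_isLmodule.Build R W
  rscaleA rscale1 rscaleDr rscaleDl.

Let realify_add_continuous : continuous (fun x : W * W => x.1 + x.2).
Proof. exact: (@add_continuous V). Qed.

Let continuous_realC : continuous (fun t : R^o => (t%:C%C : R[i]^o)).
Proof.
move=> t; apply/cvgrPdist_lt => e e0.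
have eE : e = (complex.Re e)%:C%C.
  by move: e0; case: e => a b; rewrite ltcE /= => /andP[/eqP -> _].
have Re0 : 0 < complex.Re e by move: e0; rewrite eE ltcR.
have /cvgrPdist_lt/(_ _ Re0) : s @[s --> t] --> t by [].
apply: filterS => s; rewrite eE -rmorphB normc_def /= expr0n addr0 ltcR.
by rewrite sqrtr_sqr.
Qed.

Let realify_scale_continuous : continuous (fun z : R^o * W => z.1 *: z.2).
Proof.
move=> [t v]; pose f (z : R^o * W) : R[i]^o * V := ((z.1)%:C%C, z.2 : V).
suff fc : {for (t, v), continuous f}.
  exact: (@continuous_comp _ _ _ f (fun z : R[i]^o * V => z.1 *: z.2) _ fc
    (@scale_continuous _ V _)).
apply: (@cvg_pair _ _ _ _ (nbhs (t%:C%C : R[i]^o)) (nbhs (v : V))) => /=;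
  last exact: cvg_snd.
apply: (@cvg_comp _ _ _ (fst : R^o * W -> R^o) (fun t : R^o => (t%:C%C : R[i]^o))).
  exact: cvg_fst.
exact: continuous_realC.
Qed.

Let realify_locally_convex : exists2 B : set_system W,
  (forall b, b \in B -> convex_set b) & basis B.
Proof.
have [B Bc Bb] := @locally_convex R[i] V.
exists B => // b /Bc bc x y l xb yb.
have l0 : 0 <= (l%:num)%:C%C :> R[i] by rewrite lecR.
have l1 : (l%:num)%:C%C <= 1 :> R[i] by rewrite -[1]/((1 : R)%:C%C) lecR.
have := bc x y (Itv01 l0 l1) xb yb.
congr (_ \in b); rewrite /conv /=.
by rewrite (_ : unstable.onem _ = (unstable.onem (l%:num))%:C%C) //
  /unstable.onem rmorphB.
Qed.

HB.instance Definition _ :=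
  PreTopologicalNmodule_isTopologicalNmodule.Build W realify_add_continuous.
HB.instance Definition _ :=
  TopologicalNmodule_isTopologicalLmodule.Build R W realify_scale_continuous.
HB.instance Definition _ := Uniform_isTvs.Build R W realify_locally_convex.

End Realify.

(* Smooth maps between locally convex spaces in the sense of Michal-Bastiani.
   The library's [derive] and [derivable] only cover normed modules. *)
Section Calculus.
Context {R : realType}.

Definition diff_quotient {E F : tvsType R} (f : E -> F) (x v : E) (h : R) : F :=
  h^-1 *: (f (h *: v + x) - f x).

Definition has_dderiv {E F : tvsType R} (f : E -> F) (x v : E) : Prop :=
  exists l : F, diff_quotient f x v @ (0 : R)^' --> l.

(* Meaningful only under [has_dderiv f x v], with F Hausdorff. *)
Definition dderiv {E F : tvsType R} (f : E -> F) (x v : E) : F :=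
  xget 0 [set l : F | diff_quotient f x v @ (0 : R)^' --> l].

Definition continuous_on {X Y : topologicalType} (U : set X) (f : X -> Y) :=
  forall x, U x -> {for x, continuous f}.

(* f is C^(k+1) on the open set U if all directional derivatives exist and
   df : U x E -> F is C^k. *)
Fixpoint Ck {F : tvsType R} (k : nat) :
    forall E : tvsType R, set E -> (E -> F) -> Prop :=
  match k with
  | 0 => fun E U f => continuous_on U f
  | k'.+1 => fun E U f =>
      [/\ continuous_on U f,
          forall x v, U x -> has_dderiv f x v &
          @Ck F k' (E * E)%type (U `*` setT) (fun z => dderiv f z.1 z.2)]
  end.

Definition smooth_on {E F : tvsType R} (U : set E) (f : E -> F) : Prop :=
  forall k, Ck k U f.

End Calculus.

Section Manifolds.
Context {R : realType}.

(* A chart is given as total maps which only matter on [cdom], resp. on the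
   image of [cdom]. *)
Record chart (M : topologicalType) (E : tvsType R) := Chart {
  cdom : set M;
  cfun :> M -> E;
  cinv : E -> M
}.

Definition is_chart M E (c : chart M E) : Prop :=
  [/\ open (cdom c), open (c @` cdom c),
      forall p, cdom c p -> cinv c (c p) = p,
      continuous_on (cdom c) c &
      continuous_on (c @` cdom c) (cinv c)].

Definition is_atlas M E (A : set (chart M E)) : Prop :=
  [/\ forall c, A c -> is_chart c,
      forall p : M, exists2 c, A c & cdom c p &
      forall c d, A c -> A d ->
        smooth_on (c @` (cdom c `&` cdom d)) (d \o cinv c)].

Definition prod_chart M E N F (c : chart M E) (d : chart N F) :
    chart (M * N)%type (E * F)%type :=
  Chart (cdom c `*` cdom d) (fun p => (c p.1, d p.2))
        (fun u => (cinv c u.1, cinv d u.2)).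

Definition prod_atlas M E N F (A : set (chart M E)) (B : set (chart N F)) :
    set (chart (M * N)%type (E * F)%type) :=
  [set prod_chart c d | c in A & d in B].

Definition tvs_atlas (E : tvsType R) : set (chart E E) :=
  [set Chart setT id id].

Definition smooth_map M E N F (A : set (chart M E)) (B : set (chart N F))
    (f : M -> N) : Prop :=
  continuous f /\
  forall c d, A c -> B d ->
    smooth_on (c @` (cdom c `&` f @^-1` cdom d)) (d \o f \o cinv c).

End Manifolds.

Arguments tvs_atlas {R} E.

#[short(type="pretopologicalGroupType")]
HB.structure Definition PreTopologicalGroup := {G of Topological G & Group G}.

Section LieGroups.
Context {R : realType}.
Implicit Types E : tvsType R.
Implicit Types G : pretopologicalGroupType.

(* The Lie algebra T_1 G is identified with the model space E by means of the
   distinguished (but arbitrary) chart c around 1; x : E stands for the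
   velocity at t = 0 of the curve t |-> c^-1 (c 1 + t x). *)
Section Coordinates.
Context {E : tvsType R} {G : pretopologicalGroupType} (c : chart G E).

(* The left invariant vector field g |-> T(lambda_g) x, read in the chart c. *)
Definition left_invariant_field (x u : E) : E :=
  dderiv (fun v => c (cinv c u * cinv c v)%g) (c 1%g) x.

Definition field_bracket (X Y : E -> E) (u : E) : E :=
  dderiv Y u (X u) - dderiv X u (Y u).

Definition chart_bracket (x y : E) : E :=
  field_bracket (left_invariant_field x) (left_invariant_field y) (c 1%g).

(* The velocity at 0 of a curve gamma in G with gamma 0 = 1. *)
Definition velocity (gamma : R -> G) : E :=
  dderiv (fun t : R^o => c (gamma t)) 0 1.

End Coordinates.

Record lieGroup (E : tvsType R) (G : pretopologicalGroupType) := LieGroup {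
  lg_atlas : set (chart G E);
  lg_one : chart G E;
  lg_exp : E -> G;
  lg_model_hausdorff : hausdorff_space E;
  lg_hausdorff : hausdorff_space G;
  lg_atlasP : is_atlas lg_atlas;
  lg_oneP : lg_atlas lg_one /\ cdom lg_one 1%g;
  lg_mulP : smooth_map (prod_atlas lg_atlas lg_atlas) lg_atlas
              (fun p : G * G => (p.1 * p.2)%g);
  lg_invP : smooth_map lg_atlas lg_atlas (fun g : G => (g^-1)%g);
  lg_exp_smooth : smooth_map (tvs_atlas E) lg_atlas lg_exp;
  lg_exp_add : forall (x : E) (s t : R),
    lg_exp ((s + t) *: x) = (lg_exp (s *: x) * lg_exp (t *: x))%g;
  lg_exp_velocity : forall x : E,
    velocity lg_one (fun t => lg_exp (t *: x)) = x
}.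

Definition bracket E G (L : lieGroup E G) : E -> E -> E :=
  chart_bracket (lg_one L).

(* Lie(f) = T_1(f) for a smooth homomorphism f. *)
Definition lie_map E G E' G' (L : lieGroup E G) (L' : lieGroup E' G')
    (f : G -> G') (x : E) : E' :=
  dderiv (lg_one L' \o f \o cinv (lg_one L)) (lg_one L 1%g) x.

End LieGroups.

Section Actions.
Context {R : realType} {E : tvsType R} {G : pretopologicalGroupType}.
Variables (L : lieGroup E G) (alpha : R -> G -> G).

Definition smooth_action : Prop :=
  [/\ forall g, alpha 0 g = g,
      forall s t g, alpha (s + t) g = alpha s (alpha t g),
      forall t g h, alpha t (g * h)%g = (alpha t g * alpha t h)%g &
      smooth_map (prod_atlas (tvs_atlas R^o) (lg_atlas L)) (lg_atlas L)
        (fun p : R^o * G => alpha p.1 p.2)].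

Definition lie_action (t : R) : E -> E := lie_map L L (alpha t).

Definition action_derivation (x : E) : E :=
  dderiv (fun t : R^o => lie_action t x) 0 1.

Definition fixed_group : set G := [set g | forall t, alpha t g = g].

Definition fixed_algebra : set E := [set x | forall t, lie_action t x = x].

Definition g_plus : set E := closure (range action_derivation).

(* (G0, L0) with inclusion iota is a Lie group structure on the fixed point
   group whose Lie algebra is the fixed point algebra: T_1(iota) is an
   isomorphism of topological vector spaces onto the latter. The group topology
   of G0 may be finer than the subspace topology. *)
Definition fixed_lie_group (E0 : tvsType R) (G0 : pretopologicalGroupType)
    (L0 : lieGroup E0 G0) (iota : G0 -> G) : Prop :=
  [/\ {morph iota : g h / (g * h)%g}, injective iota /\ range iota = fixed_group,
      smooth_map (lg_atlas L0) (lg_atlas L) iota,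
      injective (lie_map L0 L iota) /\
        range (lie_map L0 L iota) = fixed_algebra &
      forall V : set E0, open V <->
        exists2 W : set E, open W & V = lie_map L0 L iota @^-1` W].

End Actions.

Section LocallyConvex.
Context {R : realType} {E : tvsType R}.

(* Addition A x B -> E is a bijection with continuous inverse. *)
Definition top_direct_sum (A B : set E) : Prop :=
  (forall a a' b b', A a -> A a' -> B b -> B b' ->
     a + b = a' + b' -> a = a' /\ b = b') /\
  exists q : E -> E * E, continuous q /\
    forall z, [/\ A (q z).1, B (q z).2 & (q z).1 + (q z).2 = z].

(* If E = A + B is direct, p is the projection onto A with kernel B. *)
Definition projection_along (A B : set E) (p : E -> E) : Prop :=
  forall z, A (p z) /\ B (z - p z).

Definition convex_hull (S : set E) : set E :=
  [set x | exists n (a : 'I_n -> R) (v : 'I_n -> E),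
     [/\ forall i, 0 <= a i, \sum_i a i = 1, forall i, S (v i) &
         x = \sum_i a i *: v i]].

End LocallyConvex.

Section HilbertSpaces.
Context {R : realType} {H : completeNormedModType R[i]}.
Variable dot : {dot H for Num.conj}.

Definition is_hilbert : Prop := forall x : H, `|x| ^+ 2 = dot x x.

Definition unitary_operator (u : H -> H) : Prop :=
  [/\ forall (a : R[i]) x y, u (a *: x + y) = a *: u x + u y,
      forall x y, dot (u x) (u y) = dot x y &
      range u = setT].

(* Strongly continuous unitary representation of a group (T, op, e). *)
Definition unitary_rep (T : topologicalType) (op : T -> T -> T) (e : T)
    (rho : T -> H -> H) : Prop :=
  [/\ forall g, unitary_operator (rho g),
      forall x, rho e x = x,
      forall g h x, rho (op g h) x = rho g (rho h x) &
      forall x, continuous (fun g => rho g x)].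

Definition linear_span (S : set H) : set H :=
  [set x | exists n (a : 'I_n -> R[i]) (v : 'I_n -> H),
     (forall i, S (v i)) /\ x = \sum_i a i *: v i].

(* Unbounded operators; the values outside [odom] are irrelevant. *)
Record operator := Operator { odom : set H; ofun :> H -> H }.

Definition eq_operator (A B : operator) : Prop :=
  odom A = odom B /\ forall x, odom A x -> A x = B x.

Definition scale_operator (a : R[i]) (A : operator) : operator :=
  Operator (odom A) (fun x => a *: A x).

Definition self_adjoint (A : operator) : Prop :=
  [/\ closure (odom A) = setT,
      forall (a : R[i]) x y, odom A x -> odom A y ->
        odom A (a *: x + y) /\ A (a *: x + y) = a *: A x + A y &
      forall y z, (forall x, odom A x -> dot (A x) y = dot x z) <->
        (odom A y /\ A y = z)].

(* On R[i], 0 <= z means that z is real and nonnegative. *)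
Definition nonneg_operator (A : operator) : Prop :=
  forall x, odom A x -> 0 <= dot (A x) x.

(* Infinitesimal generator of a one-parameter group acting on the closed
   subspace K of H. *)
Definition generator (K : set H) (V : R -> H -> H) : operator :=
  let orbit x := (fun t : R^o => (V t x : realify H)) in
  Operator [set x | K x /\ has_dderiv (orbit x) 0 1]
           (fun x => dderiv (orbit x) 0 1).

(* U_t = e^{itA} for self-adjoint A, in the sense of Stone's theorem: iA is the
   infinitesimal generator of U. *)
Definition is_exp_i (A : operator) (U : R -> H -> H) : Prop :=
  eq_operator (generator setT U) (scale_operator 'i%C A).

Definition ker (A : operator) : set H := [set x | odom A x /\ A x = 0].

Section Representations.
Context {E : tvsType R} {G : pretopologicalGroupType}.
Variables (L : lieGroup E G) (alpha : R -> G -> G).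

(* The operator d rho(x) on K, for a representation rho of G on the closed
   subspace K of H. *)
Definition derived_operator (K : set H) (rho : G -> H -> H) (x : E) : operator :=
  generator K (fun t => rho (lg_exp L (t *: x))).

(* {x | -i d rho(x) >= 0} *)
Definition positive_cone (K : set H) (rho : G -> H -> H) : set E :=
  [set x | nonneg_operator (scale_operator (- 'i%C) (derived_operator K rho x))].

Definition smooth_vectors (rho : G -> H -> H) : set H :=
  [set x | smooth_map (lg_atlas L) (tvs_atlas (realify H))
             (fun g => (rho g x : realify H))].

Definition positive_energy_rep (pi : G -> H -> H) (U : R -> H -> H)
    (A : operator) : Prop :=
  [/\ unitary_rep *%g 1%g pi, unitary_rep +%R 0 U,
      self_adjoint A /\ nonneg_operator A, is_exp_i A U &
      forall t g x, U t (pi g (U (- t) x)) = pi (alpha t g) x].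

Definition ground_state_rep pi U A : Prop :=
  positive_energy_rep pi U A /\
  closure (linear_span [set pi g x | g in setT & x in ker A]) = setT.

Definition smooth_ground_state_rep pi U A : Prop :=
  ground_state_rep pi U A /\
  ker A `<=` closure (ker A `&` smooth_vectors pi).

End Representations.
End HilbertSpaces.

Section Cones.
Context {R : realType} {E : tvsType R} {G : pretopologicalGroupType}.
Variables (L : lieGroup E G) (alpha : R -> G -> G).

Definition C_alpha (p0 : E -> E) : set E :=
  closure (convex_hull
    (range (fun x => p0 (bracket L (action_derivation L alpha x) x)))).

End Cones.

(* Main.v *)
(* For xi in H^0 write T x = d pi(x) xi.  Since U fixes xi, covariance gives
   U_t T x = T (alpha_t x), hence T (Dx) = i H T x and H >= 0 yields
   Im <T Dx, T x> >= 0.  The same covariance shows <T (Dz), xi> = 0, so that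
   Im <T y, xi> only depends on p_0 y, and <T [x,y], xi> = <T x, T y> - <T y, T x>
   turns the inequality into Im <T p_0 [Dx,x], xi> >= 0.  This is linear and
   continuous in the Lie algebra element and so extends to the closed convex cone.
   Finally the vectors xi for which this makes sense form a dense G^0-invariant
   subspace of H^0, hence a core for every d pi^0(z).

   Second derivatives of orbit maps are never needed: [x,y] is the limit of
   s^-2 (c(gh) - c(hg)) for g = exp sx, h = exp sy in a chart c, and a strict
   first derivative of the orbit map transports this difference to H. *)
Require Import Defs.
From HB Require Import structures.
From mathcomp Require Import all_boot all_order all_algebra.
From mathcomp Require Import sesquilinear complex.
From mathcomp Require Import boolp classical_sets reals topology normedtype.
From mathcomp Require Import interval_inference convex ring lra.

Set Implicit Arguments.
Unset Strict Implicit.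
Unset Printing Implicit Defensive.

Import Order.TTheory GRing.Theory Num.Theory.
Import numFieldNormedType.Exports.
Local Open Scope classical_set_scope.
Local Open Scope ring_scope.

(** * Calculus in locally convex spaces *)

Section TvsLimits.
Context {R : numFieldType} {E : tvsType R} {T : Type} {F : set_system T}.
Context {FF : Filter F}.

(** They are replaced by a mean value theorem with values in open convex sets, combined with joint
    continuity of the differential. This gives derivatives tested along two independently moving
    curves p and q, with a free rate of scaling. Rate h yields velocities, rate h^2 yields brackets,
    and the freedom of both endpoints makes the derivative additive. Invariance of the chosen class
    of vectors comes from pi(x) pi(g) xi = pi(g) pi(g^-1 x g) xi, so only conjugation has to be
    differentiated. The core argument uses finite averages over an orbit, hence no vector-valued
    integration. For a generator B of a unitary group, isometry forces Re <B x, x> = 0. Thus <-i B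
    x, x> = Im <B x, x>, and it suffices to bound imaginary parts. *)

Lemma tvs_cvgD (f g : T -> E) (a b : E) :
  f x @[x --> F] --> a -> g x @[x --> F] --> b ->
  f x + g x @[x --> F] --> a + b.
Proof.
move=> fa gb.
exact: (cvg_comp (fun x => (f x, g x)) (fun z : E * E => z.1 + z.2)
  (cvg_pair fa gb) (@add_continuous E (a, b))).
Qed.

Lemma tvs_cvgZ (s : T -> R^o) (f : T -> E) (k : R) (a : E) :
  s x @[x --> F] --> (k : R^o) -> f x @[x --> F] --> a ->
  s x *: f x @[x --> F] --> k *: a.
Proof.
move=> sk fa.
exact: (cvg_comp (fun x => (s x, f x)) (fun z : R^o * E => z.1 *: z.2)
  (cvg_pair sk fa) (@scale_continuous R E (k, a))).
Qed.

Lemma tvs_cvgZl (k : R) (f : T -> E) (a : E) :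
  f x @[x --> F] --> a -> k *: f x @[x --> F] --> k *: a.
Proof. by move=> fa; apply: tvs_cvgZ fa; exact: cvg_cst. Qed.

Lemma tvs_cvgN (f : T -> E) (a : E) :
  f x @[x --> F] --> a -> - f x @[x --> F] --> - a.
Proof.
move=> fa; rewrite -scaleN1r; under eq_fun do rewrite -scaleN1r.
exact: tvs_cvgZl.
Qed.

Lemma tvs_cvgB (f g : T -> E) (a b : E) :
  f x @[x --> F] --> a -> g x @[x --> F] --> b ->
  f x - g x @[x --> F] --> a - b.
Proof. by move=> fa gb; apply: tvs_cvgD => //; exact: tvs_cvgN. Qed.

Lemma tvs_cvg_sum n (f : 'I_n -> T -> E) (a : 'I_n -> E) :
  (forall i, f i x @[x --> F] --> a i) ->
  \sum_i f i x @[x --> F] --> \sum_i a i.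
Proof.
elim: n f a => [|n IH] f a fa.
  by rewrite big_ord0; under eq_fun do rewrite big_ord0; exact: cvg_cst.
rewrite big_ord_recr /=; under eq_fun do rewrite big_ord_recr /=.
by apply: tvs_cvgD; [apply: IH|exact: fa].
Qed.

End TvsLimits.

(** * Mean value theorem with values in an open convex set *)

Section MeanValue.
Context {R : realType}.
Implicit Types E F : tvsType R.

Lemma convex_set_comb E (C : set E) (x y : E) (s t : R) : convex_set C ->
  0 <= s -> 0 <= t -> s + t = 1 -> C x -> C y -> C (s *: x + t *: y).
Proof.
move=> Cc s0 t0 st1 Cx Cy.
have s1 : s <= 1 by rewrite -st1 lerDl.
have /set_mem := Cc x y (Itv01 s0 s1) (mem_set Cx) (mem_set Cy).
rewrite /conv /= (_ : unstable.onem _ = t) //.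
by rewrite /unstable.onem -st1 addrAC subrr add0r.
Qed.

Lemma convex_nbhs E (x : E) (U : set E) : nbhs x U ->
  exists C, [/\ open C, C x, C `<=` U & convex_set C].
Proof.
move=> xU; have [B Bc [Bo Bb]] := @locally_convex R E.
have [C [BC Cx] CU] := Bb x U xU.
by exists C; split => //; [exact: Bo|apply: Bc; exact: mem_set].
Qed.

(** A supremum argument takes the place of separating functionals: openness of [C] puts the slopes
    near each point into [C], and the slope over two adjacent intervals is a convex combination of
    their slopes. *)
Lemma mean_value_convex F (f df : R -> F) (C : set F) :
  open C -> convex_set C ->
  (forall t, 0 <= t <= 1 ->
     h^-1 *: (f (h + t) - f t) @[h --> (0 : R)^'] --> df t /\ C (df t)) ->
  C (f 1 - f 0).
Proof.
move=> oC cC fdf.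
pose slope a b := (b - a)^-1 *: (f b - f a).
have slopeC a b : slope a b = slope b a.
  by rewrite /slope -(opprB b a) -(opprB (f b)) invrN scaleNr scalerN opprK.
have slope_add a b c : a < b -> b < c -> C (slope a b) -> C (slope b c) ->
    C (slope a c).
  move=> ab bc Cab Cbc; have ac := lt_trans ab bc.
  have ba0 : b - a != 0 by rewrite subr_eq0 gt_eqF.
  have cb0 : c - b != 0 by rewrite subr_eq0 gt_eqF.
  have ca0 : 0 < c - a by rewrite subr_gt0.
  have -> : slope a c = ((b - a) / (c - a)) *: slope a b +
                        ((c - b) / (c - a)) *: slope b c.
    rewrite /slope !scalerA ![_ / (c - a)]mulrC !mulfK //.
    by rewrite -scalerDr [f b - _ + _]addrC addrA subrK.
  apply: convex_set_comb => //.
  - by rewrite divr_ge0 // ?subr_ge0 ltW.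
  - by rewrite divr_ge0 // ?subr_ge0 ltW.
  - by rewrite -mulrDl [b - a + _]addrC addrA subrK divff // gt_eqF.
have local t : 0 <= t <= 1 ->
    exists2 d, 0 < d & forall s, `|s - t| < d -> s != t -> C (slope t s).
  move=> /fdf[ft Ct]; have := ft _ (open_nbhs_nbhs (conj oC Ct)).
  rewrite /nbhs /= /dnbhs /within /= => /nbhs_ballP[d /= d0 dC].
  exists d => // s sd st; have := dC (s - t).
  rewrite subr_eq0 /slope -[in f s](subrK t s); apply => //.
  by rewrite /ball /= sub0r normrN.
(* The point 0 is added by hand: [slope 0 0] is 0 by the convention for inverses and need not lie in
   [C]. *)
pose S := [set t | 0 <= t <= 1 /\ (t = 0 \/ C (slope 0 t))].
have S0 : S 0 by split; [rewrite lexx ler01|left].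
have S1 t : S t -> t <= 1 by case=> /andP[].
have supS : has_sup S by split; [exists 0|exists 1 => t /S1].
set s := sup S.
have s01 : 0 <= s <= 1.
  by apply/andP; split; [apply: sup_upper_bound|apply: sup_le_ub;
    [exists 0|move=> t /S1]].
have [d d0 dC] := local _ s01.
have step a b : S a -> a < b -> 0 <= b <= 1 -> C (slope a b) -> S b.
  move=> [/andP[a0 a1] aS] ab b01 Cab; split=> //; right.
  case: aS => [a00|Ca]; first by rewrite -a00.
  move: a0; rewrite le_eqVlt => /predU1P[a00|a0]; first by rewrite a00.
  exact: slope_add Ca Cab.
have Ss : S s.
  have [a Sa sa] := sup_adherent d0 supS; rewrite -/s in sa.
  have as_ : a <= s by apply: sup_upper_bound.
  move: as_; rewrite le_eqVlt => /predU1P[<- //|as_].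
  apply: (step a) => //; rewrite slopeC; apply: dC; last by rewrite lt_eqF.
  by rewrite distrC ger0_norm ?subr_ge0 ?(ltW as_) // ltrBlDr -ltrBlDl.
case/andP: (s01) => s0; rewrite le_eqVlt => /predU1P[s1|s1].
  move: Ss; rewrite s1 => -[_ [/eqP|]]; first by rewrite oner_eq0.
  by rewrite /slope subr0 invr1 scale1r.
(* If s < 1, a point [b] beyond the supremum still belongs to [S]; halving [d] keeps it strictly
   inside the radius of local control. *)
pose b := Num.min 1 (s + d / 2).
have sb : s < b by rewrite lt_min s1 ltrDl divr_gt0.
have b1 : b <= 1 by rewrite ge_min lexx.
have b01 : 0 <= b <= 1 by rewrite b1 (le_trans s0 (ltW sb)).
have Sb : S b.
  apply: (step s) => //; apply: dC; last by rewrite gt_eqF.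
  rewrite ger0_norm ?subr_ge0 ?(ltW sb) // ltrBlDl.
  by rewrite (@le_lt_trans _ _ (s + d / 2)) ?ge_min ?lexx ?orbT // ltrD2l
    gtr_pMr // invf_lt1 // ltr1n.
by have := sup_upper_bound supS Sb; rewrite leNgt sb.
Qed.

End MeanValue.

(** * First and second order difference quotients *)

Section DirectionalDerivatives.
Context {R : realType}.
Implicit Types E F : tvsType R.

Lemma dderivP E F (f : E -> F) (x v : E) : has_dderiv f x v ->
  diff_quotient f x v @ (0 : R)^' --> dderiv f x v.
Proof. by move=> fl; have := xgetPex (0 : F) fl. Qed.

Lemma dderiv_unique E F (f : E -> F) (x v : E) (l : F) : hausdorff_space F ->
  diff_quotient f x v @ (0 : R)^' --> l -> dderiv f x v = l.
Proof.
move=> hF fl; have fd := dderivP (ex_intro _ l fl).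
exact: (cvg_unique hF fd fl).
Qed.

Lemma dnbhs0_mul (k : R) : k != 0 -> h * k @[h --> (0 : R)^'] --> (0 : R)^'.
Proof.
move=> k0 U /nbhs_ballP[d /= d0 dU].
apply/nbhs_ballP; exists (d / `|k|) => /=; first by rewrite divr_gt0 ?normr_gt0.
move=> h; rewrite /ball /= sub0r normrN => hd h0; apply: dU.
  by rewrite /ball /= sub0r normrN normrM -ltr_pdivlMr ?normr_gt0.
by rewrite mulf_neq0.
Qed.

(** Dividing by [r] before applying the mean value theorem leaves [C] unscaled and allows either
    sign of [r]. *)
Lemma mean_value_segment E F (f : E -> F) (df : R -> F) (x v : E) (r : R)
    (C : set F) : open C -> convex_set C -> r != 0 ->
  (forall t, 0 <= t <= 1 ->
     diff_quotient f (t *: (r *: v) + x) v @ (0 : R)^' --> df t /\ C (df t)) ->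
  C (r^-1 *: (f (r *: v + x) - f x)).
Proof.
move=> oC cC r0 fdf.
have := @mean_value_convex R F (fun t => r^-1 *: f (t *: (r *: v) + x)) df C oC cC.
rewrite scale1r scale0r add0r -scalerBr; apply => t t01.
have [ft Ct] := fdf t t01; split=> //.
have := cvg_comp _ _ (dnbhs0_mul r0) ft.
rewrite (_ : _ \o _ =
  fun h => h^-1 *: (r^-1 *: f ((h + t) *: (r *: v) + x)
                    - r^-1 *: f (t *: (r *: v) + x))) //.
apply/funext => h;
  rewrite /= /diff_quotient invfM -[in LHS]scalerA -scalerBr scalerDl addrA.
by rewrite !scalerA.
Qed.

Lemma convex_set_segment E (A : set E) (p q : E) (t : R) : convex_set A ->
  0 <= t <= 1 -> A p -> A q -> A (t *: (p - q) + q).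
Proof.
move=> cA /andP[t0 t1] Ap Aq.
rewrite scalerBr -addrA -[X in - (t *: q) + X]scale1r -scaleNr -scalerDl addrC.
rewrite addrC; apply: convex_set_comb => //; first by rewrite addrC subr_ge0.
by rewrite addrA subrr add0r.
Qed.

Local Notation dn := (0 : R)^'.

Lemma scale_add_pair E1 E2 (k : R) (a c : E1) (b d : E2) :
  k *: (a, b) + (c, d) = (k *: a + c, k *: b + d).
Proof. by []. Qed.

Lemma diff_quotient_pair2 E1 E2 F (m : E1 * E2 -> F) (u : E1) (v w : E2) :
  diff_quotient m (u, v) (0, w) = diff_quotient (fun v => m (u, v)) v w.
Proof.
apply/funext => k; congr (_ *: (m _ - _)).
by rewrite scale_add_pair scaler0 add0r.
Qed.

Lemma dderiv_pair2 E1 E2 F (m : E1 * E2 -> F) (u : E1) (v w : E2) :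
  dderiv m (u, v) (0, w) = dderiv (fun v => m (u, v)) v w.
Proof. by rewrite /dderiv diff_quotient_pair2. Qed.

(** With v the scaled difference, p h = r h *: v + q h holds exactly, without remainder. A product
    of neighbourhoods of a and w on which the differential stays in [C], the first factor convex,
    contains the whole segment together with v, and the mean value theorem concludes. *)
Lemma C1_strict E F (f : E -> F) (W : set E) (a w : E) (r : R -> R)
    (p q : R -> E) : open W -> Ck 1 W f -> W a ->
  (\forall h \near dn, r h != 0) -> p h @[h --> dn] --> a ->
  q h @[h --> dn] --> a -> (r h)^-1 *: (p h - q h) @[h --> dn] --> w ->
  (r h)^-1 *: (f (p h) - f (q h)) @[h --> dn] --> dderiv f a w.
Proof.
move=> oW [_ df cdf] Wa r0 pa qa pqw.
move=> U /convex_nbhs[C [oC Ca CU cC]].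
have /= := cdf (a, w) (conj Wa I) _ (open_nbhs_nbhs (conj oC Ca)).
move=> -[[A0 B] /= [A0a Bw] ABC].
have : nbhs a (A0 `&` W) by apply: filterI => //; exact: open_nbhs_nbhs.
move=> /convex_nbhs[A [oA Aa AA cA]].
have {}Aa : nbhs a A by exact: open_nbhs_nbhs.
suff Cn : \forall h \near dn, C ((r h)^-1 *: (f (p h) - f (q h))).
  by apply: filterS Cn => h /CU.
near=> h.
have rh : r h != 0 by near: h.
have Ap : A (p h) by near: h; exact: pa.
have Aq : A (q h) by near: h; exact: qa.
have Bh : B ((r h)^-1 *: (p h - q h)) by near: h; exact: pqw.
set v := _ *: (p h - q h) in Bh.
have rv : p h - q h = r h *: v by rewrite scalerA divff ?scale1r.
rewrite [X in f X](_ : _ = r h *: v + q h); last by rewrite -rv subrK.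
apply: (@mean_value_segment _ _ f (fun t => dderiv f (t *: (r h *: v) + q h)
  v)) => //.
move=> t t01.
have At : A (t *: (r h *: v) + q h) by rewrite -rv; exact: convex_set_segment.
have [At0 Wt] := AA _ At.
by split; [apply/dderivP/df|exact: (ABC (_, v))].
Unshelve. all: by end_near. Qed.

(* The mixed difference is controlled by two applications of the mean value
   theorem, so that no symmetry of second derivatives is involved. *)
Lemma C2_mixed_difference E1 E2 F (m : E1 * E2 -> F) (W : set (E1 * E2))
    (a x : E1) (b y : E2) (p : R -> E1) (q : R -> E2) :
  open W -> Ck 2 W m -> W (a, b) ->
  p h @[h --> dn] --> a -> q h @[h --> dn] --> b ->
  h^-1 *: (p h - a) @[h --> dn] --> x ->
  h^-1 *: (q h - b) @[h --> dn] --> y ->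
  (h ^- 2) *: (m (p h, q h) - m (a, q h) - (m (p h, b) - m (a, b)))
    @[h --> dn] --> dderiv (fun u => dderiv (fun v => m (u, v)) b y) a x.
Proof.
move=> oW [_ dm [_ ddm cddm]] Wab pa qb px qy.
(* The partial derivatives are written as total differentials in directions padded by zeros, because
   continuity of the second differential is only given for the latter. *)
pose D (u : E1) (v w : E2) : F := dderiv m (u, v) (0, w).
pose DD (u x : E1) (v w : E2) : F := dderiv (fun z => dderiv m z.1 z.2)
  ((u, v), (0, w)) ((x, 0), (0, 0)).
have DDE u x' v w : diff_quotient (fun z => dderiv m z.1 z.2)
    ((u, v), (0, w)) ((x', 0), (0, 0)) = diff_quotient (fun u => D u v w) u x'.
  apply/funext => k; congr (_ *: (_ - _)).
  by rewrite !scale_add_pair !scaler0 !add0r.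
have -> : dderiv (fun u => dderiv (fun v => m (u, v)) b y) a x = DD a x b y.
  rewrite (_ : (fun u => _) = (fun u => D u b y)); last first.
    by apply/funext => u; rewrite /D dderiv_pair2.
  by rewrite /DD /dderiv DDE.
move=> U /convex_nbhs[C [oC Ca CU cC]].
have /= := cddm ((a, b), (0, y), ((x, 0), (0, 0))) (conj (conj Wab I) I) _
  (open_nbhs_nbhs (conj oC Ca)).
move=> -[[P Q] /= [[[AB Y'] /= [ABab Y'y] ABY'P] [[X' Z] /= [X'x Z0] XZQ]] PQC].
have [X0 X0x X0X] : exists2 X0 : set E1, nbhs x X0 & forall x', X0 x' -> X' (x', 0).
  case: X'x => -[X1 X2] /= [X1x X20] X12; exists X1 => // x' X1x'.
  by apply: X12; split => //=; exact: nbhs_singleton.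
have [Y0 Y0y Y0Y] : exists2 Y0 : set E2, nbhs y Y0 & forall y', Y0 y' -> Y' (0, y').
  case: Y'y => -[Y1 Y2] /= [Y10 Y2y] Y12; exists Y2 => // y' Y2y'.
  by apply: Y12; split => //=; exact: nbhs_singleton.
have {}Z0 : Z (0, 0) by exact: nbhs_singleton.
have : nbhs (a, b) (AB `&` W) by apply: filterI => //; exact: open_nbhs_nbhs.
case=> -[A0 B0] /= [/convex_nbhs[A [oA Aa AA0 cA]] /convex_nbhs[B [oB Bb BB0
  cB]]] A0B0.
have ABC u v y' x' : A u -> B v -> Y0 y' -> X0 x' ->
    W (u, v) /\ C (DD u x' v y').
  move=> Au Bv Yy' Xx'.
  have [ABuv Wuv] : (AB `&` W) (u, v) by apply: A0B0; split;
    [exact: AA0|exact: BB0].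
  split=> //; apply: (PQC ((u, v), (0, y'), ((x', 0), (0, 0)))); split => /=.
    by apply: ABY'P; split => //=; exact: Y0Y.
  by apply: XZQ; split => //=; exact: X0X.
have {}Aa : nbhs a A by exact: open_nbhs_nbhs.
have {}Bb : nbhs b B by exact: open_nbhs_nbhs.
have Aa1 := nbhs_singleton Aa; have Bb1 := nbhs_singleton Bb.
suff Cn : \forall h \near dn, C ((h ^- 2) *:
    (m (p h, q h) - m (a, q h) - (m (p h, b) - m (a, b)))).
  by apply: filterS Cn => h /CU.
near=> h.
have h0 : h != 0 by near: h; exact: nbhs_dnbhs_neq.
have Ap : A (p h) by near: h; exact: pa.
have Bq : B (q h) by near: h; exact: qb.
have : X0 (h^-1 *: (p h - a)) by near: h; exact: px.
have : Y0 (h^-1 *: (q h - b)) by near: h; exact: qy.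
set y' := _ *: (q h - b); set x' := _ *: (p h - a) => Yy' Xx'.
have qy' : q h - b = h *: y' by rewrite scalerA divff ?scale1r.
have px' : p h - a = h *: x' by rewrite scalerA divff ?scale1r.
have qE : q h = h *: y' + b by rewrite -qy' subrK.
have pE : p h = h *: x' + a by rewrite -px' subrK.
(* The mixed difference is an increment of [g] in the second variable. Its derivative there is again
   a difference quotient, now in the first variable, so the same theorem applies once more. *)
pose g v := h^-1 *: (m (p h, v) - m (a, v)).
have -> : h ^- 2 *: (m (p h, q h) - m (a, q h) - (m (p h, b) - m (a, b))) =
    h^-1 *: (g (h *: y' + b) - g b).
  by rewrite -qE /g -scalerBr scalerA -expr2 exprVn.
apply: (@mean_value_segment _ _ g
  (fun t => h^-1 *: (D (p h) (t *: (h *: y') + b) y' - D a (t *: (h *: y') +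
    b) y'))) => // t t01.
set v := t *: _ + b.
have Bv : B v by rewrite /v -qy'; exact: convex_set_segment.
split.
  rewrite (_ : diff_quotient g v y' = fun k => h^-1 *:
     (diff_quotient (m : E1 * E2 -> F) (p h, v) (0, y') k
      - diff_quotient m (a, v) (0, y') k)); last first.
    apply/funext => k; rewrite !diff_quotient_pair2 /diff_quotient /g.
    by rewrite -!scalerBr !scalerA mulrC !opprD !opprK addrACA.
  apply: tvs_cvgZl; apply: tvs_cvgB; apply: dderivP; apply: dm.
    by have [] := ABC _ _ _ _ Ap Bv Yy' Xx'.
  by have [] := ABC _ _ _ _ Aa1 Bv Yy' Xx'.
rewrite pE.
apply: (@mean_value_segment _ _ (fun u => D u v y') (fun s => DD (s *: (h *:
  x') + a) x' v y')) => // s s01.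
set u := s *: _ + a.
have Au : A u by rewrite /u -px'; exact: convex_set_segment.
have [Wuv Cuv] := ABC _ _ _ _ Au Bv Yy' Xx'.
split=> //.
have := dderivP (ddm ((u, v), (0, y')) ((x', 0), (0, 0)) (conj Wuv I)).
by rewrite DDE.
Unshelve. all: by end_near. Qed.
End DirectionalDerivatives.

(** * Strict derivatives in charts *)

Section StrictDerivative.
Context {R : realType}.
Local Notation dn := (0 : R)^'.

(* The rate r is arbitrary because second order differences, r h = h ^ 2, are
   needed for the Lie bracket. *)
Definition strict_deriv {M : topologicalType} {E F : tvsType R}
    (c : M -> E) (f : M -> F) (a : M) (T : E -> F) :=
  forall (r : R -> R) (p q : R -> M) (w : E),
    (\forall h \near dn, r h != 0) ->
    p h @[h --> dn] --> a -> q h @[h --> dn] --> a ->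
    (r h)^-1 *: (c (p h) - c (q h)) @[h --> dn] --> w ->
    (r h)^-1 *: (f (p h) - f (q h)) @[h --> dn] --> T w.

Lemma strict_deriv_comp {M N : topologicalType} {E E' F : tvsType R}
    (c : M -> E) (d : N -> E') (f : M -> N) (g : N -> F) (a : M) T S :
  {for a, continuous f} -> strict_deriv c (d \o f) a T ->
  strict_deriv d g (f a) S -> strict_deriv c (g \o f) a (S \o T).
Proof.
move=> fa fT gS r p q w r0 pa qa pqw.
apply: (gS r (f \o p) (f \o q)) => //.
- exact: (cvg_comp _ _ pa fa).
- exact: (cvg_comp _ _ qa fa).
- exact: fT.
Qed.

Lemma strict_deriv_pair2 {M N : topologicalType} {E E' F : tvsType R}
    (c : chart M E) (d : chart N E') (f : M * N -> F) (a : M) (b : N) T :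
  strict_deriv (prod_chart c d) f (a, b) T ->
  strict_deriv d (fun y => f (a, y)) b (fun w => T (0, w)).
Proof.
move=> fT r p q w r0 pa qa pqw.
apply: (fT r (fun h => (a, p h)) (fun h => (a, q h))) => //.
- by apply: (@cvg_pair _ _ _ _ (nbhs a)) => //; exact: cvg_cst.
- by apply: (@cvg_pair _ _ _ _ (nbhs a)) => //; exact: cvg_cst.
- apply: (@cvg_pair _ _ _ _ (nbhs (0 : E)) (nbhs w)) => //=.
  by under eq_fun do rewrite subrr scaler0; exact: cvg_cst.
Qed.

Lemma strict_deriv_pair1 {M N : topologicalType} {E E' F : tvsType R}
    (c : chart M E) (d : chart N E') (f : M * N -> F) (a : M) (b : N) T :
  strict_deriv (prod_chart c d) f (a, b) T ->
  strict_deriv c (fun x => f (x, b)) a (fun w => T (w, 0)).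
Proof.
move=> fT r p q w r0 pa qa pqw.
apply: (fT r (fun h => (p h, b)) (fun h => (q h, b))) => //.
- by apply: (@cvg_pair _ _ _ _ (nbhs a)) => //; exact: cvg_cst.
- by apply: (@cvg_pair _ _ _ _ (nbhs a)) => //; exact: cvg_cst.
- apply: (@cvg_pair _ _ _ _ (nbhs w) (nbhs (0 : E'))) => //=.
  by under eq_fun do rewrite subrr scaler0; exact: cvg_cst.
Qed.

End StrictDerivative.

(** * Strict derivatives computed in charts *)

Section Charts.
Context {R : realType}.
Local Notation dn := (0 : R)^'.

Lemma open_continuous_on {X Y : topologicalType} (W : set X) (g : X -> Y)
    (O : set Y) : open W -> continuous_on W g -> open O -> open (W `&` g @^-1` O).
Proof.
move=> oW gW oO; rewrite openE => x [Wx Ox]; apply: filterI.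
  exact: open_nbhs_nbhs.
by apply: gW => //; exact: open_nbhs_nbhs.
Qed.

Lemma open_setX {X Y : topologicalType} (A : set X) (B : set Y) :
  open A -> open B -> open (A `*` B).
Proof.
move=> oA oB; rewrite openE => -[x y] [/= Ax By].
by exists (A, B) => //; split; exact: open_nbhs_nbhs.
Qed.

Section OneChart.
Context {M : topologicalType} {E : tvsType R} (c : chart M E).
Hypothesis cP : is_chart c.

Lemma chart_image_open (O : set M) : open O -> open (c @` (cdom c `&` O)).
Proof.
case: cP => od oi ci cc cci oO.
rewrite (_ : _ @` _ = (c @` cdom c) `&` cinv c @^-1` O).
  exact: open_continuous_on.
apply/seteqP; split=> [u [x [cx Ox] <-]|u [[x cx <-]] /=].
  by split; [exists x|rewrite /preimage /= ci].
by rewrite ci // => Ox; exists x.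
Qed.

Lemma chart_near (a : M) : cdom c a -> \forall x \near a, cdom c x.
Proof. by case: cP => od _ _ _ _ ca; exact: open_nbhs_nbhs. Qed.

Lemma chart_cvg {T : Type} {F : set_system T} {FF : Filter F} (p : T -> M) (a : M) :
  cdom c a -> p @ F --> a -> c (p x) @[x --> F] --> c a.
Proof. by case: cP => _ _ _ cc _ ca pa; exact: (cvg_comp _ _ pa (cc a ca)). Qed.

(** Test curves with linear coordinates, used to read off values of a strict derivative. The
    coordinate formula is only local, since [cinv] is meaningful only on the image of the chart. *)
Lemma chart_line (a : M) (w : E) : cdom c a ->
  let p h := cinv c (h *: w + c a) in
  p h @[h --> dn] --> a /\ (\forall h \near dn, c (p h) = h *: w + c a).
Proof.
case: cP => od oi ci cc cci ca p.
have la : h *: w + c a @[h --> dn] --> c a.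
  rewrite -[X in _ --> X]add0r -[X in _ --> X + _](scale0r w).
  apply: tvs_cvgD; last exact: cvg_cst.
  apply: tvs_cvgZ; last exact: cvg_cst.
  by apply: cvg_within_filter; exact: cvg_id.
have ica : (c @` cdom c) (c a) by exists a.
split.
  by rewrite -[X in _ --> X](ci _ ca); apply: (cvg_comp _ _ la (cci _ ica)).
have : \forall h \near dn, (c @` cdom c) (h *: w + c a).
  exact: (la _ (open_nbhs_nbhs (conj oi ica))).
apply: filterS => h [x cx xE].
by rewrite /p -xE ci.
Qed.

Lemma strict_deriv_curve {F : tvsType R} (f : M -> F) (a : M) T (w : E) :
  cdom c a -> strict_deriv c f a T ->
  h^-1 *: (f (cinv c (h *: w + c a)) - f a) @[h --> dn] --> T w.
Proof.
move=> ca fT; have [pa cp] := chart_line w ca.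
apply: (fT id _ (fun=> a)) => //; first exact: nbhs_dnbhs_neq.
  exact: cvg_cst.
apply: cvg_trans (@cvg_cst _ w _ dn _); apply: near_eq_cvg.
near=> h; have h0 : h != 0 by near: h; exact: nbhs_dnbhs_neq.
have -> : c (cinv c (h *: w + c a)) = h *: w + c a by near: h.
by rewrite addrK scalerA mulVf // scale1r.
Unshelve. all: by end_near. Qed.

Lemma strict_deriv_dderiv {F : tvsType R} (f : M -> F) (a : M) T (w : E) :
  hausdorff_space F -> cdom c a -> strict_deriv c f a T ->
  dderiv (f \o cinv c) (c a) w = T w.
Proof.
move=> hF ca fT; apply: dderiv_unique => //.
have := strict_deriv_curve (w := w) ca fT.
by case: cP => _ _ ci _ _; rewrite /diff_quotient /= ci.
Qed.

(** Strictness is what gives additivity: the increment from h y to h (x + y) is tested with both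
    endpoints away from [a], and the increment from [a] to h y is then added. *)
Lemma strict_derivD {F : tvsType R} (f : M -> F) (a : M) T :
  hausdorff_space F -> cdom c a -> strict_deriv c f a T ->
  {morph T : x y / x + y}.
Proof.
move=> hF ca fT x y.
apply: (cvg_unique hF (strict_deriv_curve (w := x + y) ca fT)).
have [p1 c1] := chart_line (x + y) ca; have [p2 c2] := chart_line y ca.
have fx : h^-1 *: (f (cinv c (h *: (x + y) + c a)) - f (cinv c (h *: y + c a)))
    @[h --> dn] --> T x.
  apply: fT => //; first exact: nbhs_dnbhs_neq.
  apply: cvg_trans (@cvg_cst _ x _ dn _); apply: near_eq_cvg.
  near=> h; have h0 : h != 0 by near: h; exact: nbhs_dnbhs_neq.
  have -> : c (cinv c (h *: (x + y) + c a)) = h *: (x + y) + c a by near: h.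
  have -> : c (cinv c (h *: y + c a)) = h *: y + c a by near: h.
  by rewrite opprD addrACA subrr addr0 -scalerBr addrK scalerA mulVf // scale1r.
have := tvs_cvgD fx (strict_deriv_curve (w := y) ca fT).
under eq_fun do rewrite -scalerDr addrA subrK.
move=> H; exact: H.
Unshelve. all: by end_near. Qed.

(** The curve with velocity k x is measured at rate h * k, where its limit is T x. This requires k
    != 0; the remaining case follows from additivity. *)
Lemma strict_derivZ {F : tvsType R} (f : M -> F) (a : M) T :
  hausdorff_space F -> cdom c a -> strict_deriv c f a T ->
  forall k x, T (k *: x) = k *: T x.
Proof.
move=> hF ca fT k x; have [->|k0] := eqVneq k 0.
  rewrite !scale0r; have T0 := strict_derivD hF ca fT 0 0.
  by apply: (@addrI _ (T 0)); rewrite addr0 -T0 addr0.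
apply: (cvg_unique hF (strict_deriv_curve (w := k *: x) ca fT)).
have [p1 c1] := chart_line (k *: x) ca.
have fx : (h * k)^-1 *: (f (cinv c (h *: (k *: x) + c a)) - f a)
    @[h --> dn] --> T x.
  apply: fT => //; last 2 first.
  - exact: cvg_cst.
  - apply: cvg_trans (@cvg_cst _ x _ dn _); apply: near_eq_cvg.
    near=> h; have h0 : h != 0 by near: h; exact: nbhs_dnbhs_neq.
    have -> : c (cinv c (h *: (k *: x) + c a)) = h *: (k *: x) + c a by near: h.
    by rewrite addrK !scalerA -mulrA mulVf ?mulf_neq0 // scale1r.
  near=> h; have h0 : h != 0 by near: h; exact: nbhs_dnbhs_neq.
  by rewrite mulf_neq0.
have := tvs_cvgZl (k := k) fx.
have kh (h : R) : k * (h * k)^-1 = h^-1 :> R.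
  by rewrite invfM mulrCA divff // mulr1.
have hk h : k *: ((h * k)^-1 *: (f (cinv c (h *: (k *: x) + c a)) - f a)) =
    h^-1 *: (f (cinv c (h *: (k *: x) + c a)) - f a).
  by rewrite [LHS]scalerA kh.
under eq_fun do rewrite hk.
move=> H; exact: H.
Unshelve. all: by end_near. Qed.

End OneChart.

Lemma prod_chart_is_chart {M N : topologicalType} {E F : tvsType R}
    (c : chart M E) (d : chart N F) :
  is_chart c -> is_chart d -> is_chart (prod_chart c d).
Proof.
move=> [od oi ci cc cci] [od' oi' ci' cc' cci']; split.
- exact: open_setX.
- rewrite (_ : _ @` _ = (c @` cdom c) `*` (d @` cdom d)); first exact: open_setX.
  apply/seteqP; split=> [_ [[x y] [/= cx dy] <-]|[u v] [[x cx /= <-] [y dy /= <-]]].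
    by split; [exists x|exists y].
  by exists (x, y).
- by move=> [x y] [/= cx dy]; rewrite ci // ci'.
- move=> [x y] [/= cx dy].
  apply: (@cvg_pair _ _ _ _ (nbhs (c x)) (nbhs (d y))).
    exact: (cvg_comp _ _ (@cvg_fst _ _ (nbhs x) (nbhs y) _) (cc x cx)).
  exact: (cvg_comp _ _ (@cvg_snd _ _ (nbhs x) (nbhs y) _) (cc' y dy)).
- move=> _ [[x y] [/= cx dy] <-] /=.
  have ix : (c @` cdom c) (c x) by exists x.
  have iy : (d @` cdom d) (d y) by exists y.
  apply: (@cvg_pair _ _ _ _ (nbhs (cinv c (c x))) (nbhs (cinv d (d y)))).
    exact: (cvg_comp _ _ (@cvg_fst _ _ (nbhs (c x)) (nbhs (d y)) _) (cci _ ix)).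
  exact: (cvg_comp _ _ (@cvg_snd _ _ (nbhs (c x)) (nbhs (d y)) _) (cci' _ iy)).
Qed.

Lemma tvs_chart_is_chart (E : tvsType R) : is_chart (Chart [set: E] id id).
Proof.
split => //=; first exact: openT.
- by rewrite image_id; exact: openT.
- by move=> x _; exact: cvg_id.
- by move=> x _; exact: cvg_id.
Qed.

Lemma smooth_map_strict {M N : topologicalType} {E F : tvsType R}
    (A : set (chart M E)) (B : set (chart N F)) (f : M -> N) c d (a : M) :
  smooth_map A B f -> A c -> B d -> is_chart c -> open (cdom d) ->
  cdom c a -> cdom d (f a) ->
  strict_deriv c (d \o f) a (dderiv (d \o f \o cinv c) (c a)) /\
  continuous (dderiv (d \o f \o cinv c) (c a)).
Proof.
move=> [fc sm] Ac Bd cP od ca da.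
have C1 := sm c d Ac Bd 1%N; case: (C1) => _ _ cdf.
set W := c @` _ in C1 cdf.
have ofd : open (f @^-1` cdom d).
  by apply: open_comp => // x _; exact: fc.
have oW : open W by exact: chart_image_open.
have Wa : W (c a) by exists a.
split=> [r p q w r0 pa qa pqw|w]; last first.
  apply: (@continuous_comp _ _ _ (fun w => (c a, w))
    (fun z => dderiv (d \o f \o cinv c) z.1 z.2) w).
    by apply: (@cvg_pair _ _ _ _ (nbhs (c a))); [exact: cvg_cst|exact: cvg_id].
  exact: cdf.
apply: cvg_trans (C1_strict oW C1 Wa r0 (chart_cvg cP ca pa)
  (chart_cvg cP ca qa) pqw); apply: near_eq_cvg; near=> h => /=.
case: (cP) => _ _ ci _ _.
have cp : cdom c (p h) by near: h; apply: pa; exact: chart_near.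
have cq : cdom c (q h) by near: h; apply: qa; exact: chart_near.
by rewrite !ci.
Unshelve. all: by end_near. Qed.

End Charts.

(** * Lie groups *)

Section LieGroupCalculus.
Context {R : realType} {E : tvsType R} {G : pretopologicalGroupType}.
Variable L : lieGroup E G.
Local Notation dn := (0 : R)^'.
Local Notation c := (lg_one L).

Lemma lg_chart d : lg_atlas L d -> is_chart d.
Proof. by case: (lg_atlasP L) => h _ _; exact: h. Qed.

Lemma lg_one_chart : is_chart c.
Proof. by apply: lg_chart; case: (lg_oneP L). Qed.

Lemma lg_one_dom : cdom c 1%g.
Proof. by case: (lg_oneP L). Qed.

Lemma lg_chart_open d : lg_atlas L d -> open (cdom d).
Proof. by case/lg_chart. Qed.

Lemma lg_chart_at (g : G) : exists2 d, lg_atlas L d & cdom d g.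
Proof. by case: (lg_atlasP L) => _ h _; exact: h. Qed.

Lemma lg_cvg_mul {T : Type} {F : set_system T} {FF : Filter F} (p q : T -> G) a b :
  p @ F --> a -> q @ F --> b -> (p x * q x)%g @[x --> F] --> (a * b)%g.
Proof.
move=> pa qb; case: (lg_mulP L) => mc _.
exact: (cvg_comp (fun x => (p x, q x)) (fun z : G * G => (z.1 * z.2)%g)
  (cvg_pair pa qb) (mc (a, b))).
Qed.

Lemma lg_exp0 : lg_exp L 0 = 1%g.
Proof.
have := lg_exp_add L 0 0 0; rewrite !scaler0 => e.
by apply: (@mulIg _ (lg_exp L 0)); rewrite mul1g -e.
Qed.

Lemma lg_expN x : lg_exp L (- x) = (lg_exp L x)^-1%g.
Proof.
apply: (@mulIg _ (lg_exp L x)); rewrite mulVg -{2}[x]scale1r -scaleN1r.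
by rewrite -lg_exp_add addNr scale0r lg_exp0.
Qed.

Lemma lg_exp_cvg x : lg_exp L (h *: x) @[h --> dn] --> 1%g.
Proof.
case: (lg_exp_smooth L) => ec _; rewrite -lg_exp0.
have hx : h *: x @[h --> dn] --> 0.
  rewrite -[X in _ --> X](scale0r x).
  apply: tvs_cvgZ; last exact: cvg_cst.
  by apply: cvg_within_filter; exact: cvg_id.
exact: (cvg_comp _ _ hx (ec 0)).
Qed.

(** Smoothness of the exponential map supplies the existence of the limit, and [lg_exp_velocity]
    then identifies its value. *)
Lemma lg_exp_strict x :
  h^-1 *: (c (lg_exp L (h *: x)) - c 1%g) @[h --> dn] --> x.
Proof.
have [Te _] := smooth_map_strict (a := 0 : E) (lg_exp_smooth L)
  (erefl : tvs_atlas E (Chart setT id id)) (proj1 (lg_oneP L))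
  (tvs_chart_is_chart E) (lg_chart_open (proj1 (lg_oneP L))) I
  (eq_ind_r (cdom c) lg_one_dom lg_exp0).
have := strict_deriv_curve (w := x) (tvs_chart_is_chart E) I Te.
rewrite /= lg_exp0; under eq_fun do rewrite addr0.
set l := dderiv _ _ _ => el.
suff lx : l = x by move: (el); rewrite lx => H; exact: H.
rewrite -[RHS](lg_exp_velocity L) /velocity; apply/esym.
apply: dderiv_unique; first exact: (lg_model_hausdorff L).
apply: cvg_trans el; apply: near_eq_cvg; near=> h.
by rewrite /diff_quotient addr0 scale0r lg_exp0 [h *: 1]mulr1.
Unshelve. all: by end_near. Qed.

Lemma strict_mul (a b : G) d e k : lg_atlas L d -> lg_atlas L e -> lg_atlas L k ->
  cdom d a -> cdom e b -> cdom k (a * b)%g ->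
  exists T, strict_deriv (prod_chart d e) (fun z => k (z.1 * z.2)%g) (a, b) T /\
    continuous T.
Proof.
move=> Ad Ae Ak da eb kab; eexists.
apply: (smooth_map_strict (a := (a, b)) (lg_mulP L) _ Ak) => //.
- by exists d => //; exists e.
- by apply: prod_chart_is_chart; exact: lg_chart.
- exact: lg_chart_open.
Qed.

(** Here T is Ad(g^-1). Conjugation is factored through left and then right multiplication, with
    charts around g^-1 and g, because these points may lie outside the chart at 1. *)
Lemma strict_conj (g : G) : exists T,
  strict_deriv c (fun x => c (g^-1 * x * g)%g) 1%g T /\ continuous T.
Proof.
have [d Ad dg] := lg_chart_at g^-1%g; have [e Ae eg] := lg_chart_at g.
have [Ac c1] := lg_oneP L.
have [|T1 [T1P T1c]] := strict_mul Ad Ac Ad dg c1; first by rewrite mulg1.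
have [|T2 [T2P T2c]] := strict_mul Ad Ae Ac dg eg; first by rewrite mulVg.
have S1 := strict_deriv_pair2 T1P; have S2 := strict_deriv_pair1 T2P.
exists (fun w => T2 (T1 (0, w), 0)); split.
  have {}S2 : strict_deriv d (fun x => c (x * g)%g) (g^-1 * 1)%g
    (fun w => T2 (w, 0)) by rewrite mulg1.
  apply: (strict_deriv_comp (f := fun x => (g^-1 * x)%g) _ S1 S2).
  by apply: lg_cvg_mul; [exact: cvg_cst|exact: cvg_id].
move=> w; apply: (@continuous_comp _ _ _ (fun w => (T1 (0, w), 0)) T2);
  last exact: T2c.
apply: (@cvg_pair _ _ _ _ (nbhs (T1 (0, w)))); last exact: cvg_cst.
apply: (@continuous_comp _ _ _ (fun w => (0, w)) T1); last exact: T1c.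
by apply: (@cvg_pair _ _ _ _ (nbhs (0 : E))); [exact: cvg_cst|exact: cvg_id].
Qed.

(** The mixed differences of the multiplication at (p, q) and at (q, p) converge to the two terms of
    [field_bracket]. *)
Lemma bracket_cvg (p q : R -> G) x y :
  p h @[h --> dn] --> 1%g -> q h @[h --> dn] --> 1%g ->
  h^-1 *: (c (p h) - c 1%g) @[h --> dn] --> x ->
  h^-1 *: (c (q h) - c 1%g) @[h --> dn] --> y ->
  h ^- 2 *: (c (p h * q h)%g - c (q h * p h)%g) @[h --> dn] --> bracket L x y.
Proof.
move=> p1 q1 px qy; set a := c 1%g.
have [Ac c1] := lg_oneP L; have cP := lg_one_chart.
have ccP := prod_chart_is_chart cP cP.
case: (lg_mulP L) => mc sm.
have cc : prod_atlas (lg_atlas L) (lg_atlas L) (prod_chart c c).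
  by exists c => //; exists c.
have C2 := sm _ _ cc Ac 2%N; move: C2.
set m := (_ \o _ \o _); set W := (_ @` _) => C2.
have oW : open W.
  apply: chart_image_open => //.
  by apply: open_comp => [z _|]; [exact: mc|exact: lg_chart_open].
have Waa : W (a, a).
  by exists (1%g, 1%g) => //=; split => //=; rewrite /preimage /= mul1g.
case: (cP) => _ _ ci _ _.
have mE g k : cdom c g -> cdom c k -> m (c g, c k) = c (g * k)%g.
  by move=> cg ck; rewrite /m /= !ci.
have lif1 z : left_invariant_field c z a = z.
  have cc1 : strict_deriv c c 1%g (@idfun E) by [].
  rewrite -[RHS](strict_deriv_dderiv cP z (lg_model_hausdorff L) c1 cc1).
  rewrite /left_invariant_field -/a; congr (dderiv _ a z); apply/funext => v /=.
  by rewrite /a ci // mul1g.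
have pc : c (p h) @[h --> dn] --> a by exact: chart_cvg.
have qc : c (q h) @[h --> dn] --> a by exact: chart_cvg.
have M1 := C2_mixed_difference oW C2 Waa pc qc px qy.
have M2 := C2_mixed_difference oW C2 Waa qc pc qy px.
rewrite /bracket /chart_bracket /field_bracket !lif1.
apply: cvg_trans (tvs_cvgB M1 M2); apply: near_eq_cvg; near=> h.
have cp : cdom c (p h) by near: h; apply: p1; exact: chart_near.
have cq : cdom c (q h) by near: h; apply: q1; exact: chart_near.
rewrite !mE // !mul1g !mulg1 -scalerBr; congr (_ *: _).
(* As 1 is neutral, both mixed differences subtract the same terms P + Q - a, which cancel in their
   difference. *)
have e (A P Q : E) : A - Q - (P - a) = A + (a - P - Q).
  by rewrite opprB -addrA; congr (_ + _); rewrite addrC.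
by rewrite !e opprD addrACA [a - _ - _]addrAC subrr addr0.
Unshelve. all: by end_near. Qed.

Lemma lie_map_strict {E' : tvsType R} {G' : pretopologicalGroupType}
    (L' : lieGroup E' G') (f : G -> G') :
  smooth_map (lg_atlas L) (lg_atlas L') f -> f 1%g = 1%g ->
  strict_deriv c (lg_one L' \o f) 1%g (lie_map L L' f) /\
  continuous (lie_map L L' f).
Proof.
move=> sf f1; have [Ac c1] := lg_oneP L; have [Ac' c1'] := lg_oneP L'.
apply: (smooth_map_strict (a := 1%g) sf) => //; first exact: lg_one_chart.
  by have [] := lg_one_chart; case: (lg_atlasP L') => h _ _; case: (h _ Ac').
by rewrite f1.
Qed.

(** * The induced action on the Lie algebra *)

Section Action.
Variable alpha : R -> G -> G.
Hypothesis alphaP : smooth_action L alpha.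

Lemma action1 t : alpha t 1%g = 1%g.
Proof.
case: alphaP => _ _ am _; apply: (@mulIg _ (alpha t 1%g)).
by rewrite -am !mul1g.
Qed.

Lemma lie_action_strict t :
  strict_deriv c (c \o alpha t) 1%g (lie_action L alpha t) /\
  continuous (lie_action L alpha t).
Proof.
case: alphaP => _ _ _ sa; have [Ac c1] := lg_oneP L.
have cc : prod_atlas (tvs_atlas R^o) (lg_atlas L)
   (prod_chart (Chart [set: R^o] id id) c).
  by exists (Chart setT id id) => //; exists c.
have [] := smooth_map_strict (a := (t : R^o, 1%g)) sa cc Ac.
- by apply: prod_chart_is_chart lg_one_chart; exact: tvs_chart_is_chart.
- exact: lg_chart_open.
- by [].
- by rewrite /= action1.
move=> /strict_deriv_pair2 + Tc; set T := dderiv _ _ in Tc * => sT.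
have TE w : T (0, w) = lie_action L alpha t w.
  by rewrite /lie_action /lie_map /T /= dderiv_pair2.
rewrite (_ : lie_action L alpha t = fun w => T (0, w)); last by apply/funext.
split=> // w.
apply: (@continuous_comp _ _ _ (fun w => (0, w)) T); last exact: Tc.
by apply: (@cvg_pair _ _ _ _ (nbhs (0 : R^o))); [exact: cvg_cst|exact: cvg_id].
Qed.

Lemma lie_action0 x : lie_action L alpha 0 x = x.
Proof.
have [a0 _ _ _] := alphaP.
have cc : strict_deriv c (c \o alpha 0) 1%g (@idfun E).
  by rewrite (_ : alpha 0 = id) //; exact/funext.
exact: (strict_deriv_dderiv lg_one_chart x (lg_model_hausdorff L) lg_one_dom cc).
Qed.

(** The curve t |-> alpha_t^g x already is a first differential of the joint action map, so its
    t-derivative is a mixed second derivative. This is why C^2 is invoked. *)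
Lemma action_derivation_cvg x :
  h^-1 *: (lie_action L alpha h x - x) @[h --> dn] --> action_derivation L alpha x.
Proof.
case: alphaP => _ _ _ [ac sa]; have [Ac c1] := lg_oneP L.
have cc : prod_atlas (tvs_atlas R^o) (lg_atlas L)
   (prod_chart (Chart [set: R^o] id id) c).
  by exists (Chart setT id id) => //; exists c.
have := sa _ _ cc Ac 2%N.
set m := (_ \o _ \o _); set W := (_ @` _) => -[_ _ [_ dm _]].
have mE t : lie_action L alpha t x = dderiv m (t, c 1%g) (0, x).
  by rewrite dderiv_pair2.
have W1 : W (0, c 1%g).
  by exists (0, 1%g) => //; split => //=; rewrite /preimage /= action1.
have dm1 := dm ((0, c 1%g), (0, x)) ((1, 0), (0, 0)) (conj W1 I).
have qE : diff_quotient (fun z => dderiv m z.1 z.2) (0, c 1%g, (0, x)) ((1,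
  0), (0, 0))
   = diff_quotient (fun t : R^o => lie_action L alpha t x) 0 1.
  apply/funext => h; congr (_ *: (_ - _)); last by rewrite mE.
  by rewrite !scale_add_pair !scaler0 !add0r -mE.
have : has_dderiv (fun t : R^o => lie_action L alpha t x) 0 1.
  by case: dm1 => l; rewrite qE; exists l.
move=> /dderivP; rewrite -/(action_derivation L alpha x).
apply: cvg_trans; apply: near_eq_cvg; near=> h.
by rewrite /diff_quotient addr0 [h *: 1]mulr1 lie_action0.
Unshelve. all: by end_near. Qed.

Lemma lie_actionD t : {morph lie_action L alpha t : x y / x + y}.
Proof.
exact: (strict_derivD lg_one_chart (lg_model_hausdorff L) lg_one_dom
  (proj1 (lie_action_strict t))).
Qed.

Lemma lie_actionZ t k x : lie_action L alpha t (k *: x) = k *: lie_action L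
  alpha t x.
Proof.
exact: (strict_derivZ lg_one_chart (lg_model_hausdorff L) lg_one_dom
  (proj1 (lie_action_strict t))).
Qed.

Lemma fixed_algebra_closed : closed (fixed_algebra L alpha).
Proof.
move=> x clx t; apply: (lg_model_hausdorff L) => A B Ax Bx.
have [_ lc] := lie_action_strict t.
have nA : nbhs x (lie_action L alpha t @^-1` A) by exact: (lc x _ Ax).
have [y [fy [Ay By]]] := clx _ (filterI nA Bx).
by exists y; split => //; rewrite -(fy t).
Qed.

Lemma fixed_algebra_comb n (a : 'I_n -> R) (v : 'I_n -> E) :
  (forall i, fixed_algebra L alpha (v i)) ->
  fixed_algebra L alpha (\sum_i a i *: v i).
Proof.
move=> fv; elim/big_rec: _ => [t|i x _ fx t].
  by have := lie_actionZ t 0 0; rewrite !scale0r.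
by rewrite lie_actionD lie_actionZ fx (fv i t).
Qed.

End Action.
End LieGroupCalculus.

(** * Generators of unitary groups *)

Section RealHilbert.
Context {R : realType} {H : completeNormedModType R[i]}.
Variable dot : {dot H for Num.conj}.
Hypothesis H_hilbert : is_hilbert dot.
Local Notation dn := (0 : R)^'.
Local Notation W := (realify H).

Lemma realify_scaleE (k : R) (x : W) : k *: x = (k%:C%C *: (x : H) : H).
Proof. by []. Qed.

Lemma realify_hausdorff : hausdorff_space W.
Proof. exact: (@norm_hausdorff _ H). Qed.

(** The norm of [H] takes values in [R[i]]; estimates are carried out in the ordered field [R]. *)
Definition rnorm (x : W) : R := complex.Re `|x : H|.

Lemma rnormE (x : W) : `|x : H| = (rnorm x)%:C%C.
Proof. by rewrite /rnorm RRe_real // ger0_real. Qed.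

Lemma rnorm_ge0 x : 0 <= rnorm x.
Proof. by rewrite -lecR -rnormE normr_ge0. Qed.

Lemma rnormD x y : rnorm (x + y) <= rnorm x + rnorm y.
Proof. by rewrite -lecR rmorphD /= -!rnormE ler_normD. Qed.

Lemma rnormN x : rnorm (- x) = rnorm x.
Proof. by rewrite /rnorm normrN. Qed.

Lemma rnormB x y : rnorm (x - y) = rnorm (y - x).
Proof. by rewrite -rnormN opprB. Qed.

Lemma rnormZ k x : rnorm (k *: x) = `|k| * rnorm x.
Proof.
apply: complexI; rewrite -rnormE realify_scaleE normrZ rmorphM /= -rnormE.
by congr (_ * _); rewrite normc_def /= expr0n addr0 sqrtr_sqr.
Qed.

Lemma rnormB_trans y x z : rnorm (x - z) <= rnorm (x - y) + rnorm (y - z).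
Proof. by rewrite -[x - z](subrKA y) rnormD. Qed.

Lemma cvg_rnormP {T : Type} {F : set_system T} {FF : Filter F} (f : T -> W) (a
  : W) :
  f @ F --> a <-> forall e : R, 0 < e -> \forall t \near F, rnorm (f t - a) < e.
Proof.
split=> [fa e e0|fe].
  have e0C : 0 < e%:C%C :> R[i] by rewrite ltcR.
  have := @cvgr_dist_lt _ H _ F FF f a fa _ e0C.
  by apply: filterS => t; rewrite distrC (rnormE (f t - a)) ltcR.
apply/(@cvgrPdist_lt _ H) => e e0.
have eE : e = (complex.Re e)%:C%C by rewrite RRe_real // gtr0_real.
have := fe (complex.Re e); rewrite -ltcR -eE => /(_ e0).
by apply: filterS => t; rewrite -ltcR -eE -rnormE distrC.
Qed.

Lemma cvg_rnorm {T : Type} {F : set_system T} {FF : Filter F} (f : T -> W) (a : W) :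
  f @ F --> a -> rnorm (f t) @[t --> F] --> rnorm a.
Proof.
move=> /cvg_rnormP fa; apply/cvgrPdist_lt => e /fa.
apply: filterS => t; apply: le_lt_trans.
have := rnormD (f t - a) a; have := rnormD (a - f t) (f t).
rewrite !subrK (rnormB a) => h1 h2.
by rewrite ler_norml; apply/andP; split; lra.
Qed.

(* The symplectic form Im <x, y>; it carries the inner product, since
   Re <x, y> = Im <i x, y>. *)
Definition sform (x y : W) : R := complex.Im (dot (x : H) (y : H)).

Lemma sformDl x y z : sform (x + y) z = sform x z + sform y z.
Proof. by rewrite /sform linearDl raddfD. Qed.

Lemma sformDr x y z : sform x (y + z) = sform x y + sform x z.
Proof. by rewrite /sform linearDr raddfD. Qed.

Lemma sformNl x y : sform (- x) y = - sform x y.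
Proof. by rewrite /sform linearNl raddfN. Qed.

Lemma sformNr x y : sform x (- y) = - sform x y.
Proof. by rewrite /sform linearNr raddfN. Qed.

Lemma sformZl k x y : sform (k *: x) y = k * sform x y.
Proof.
by rewrite /sform realify_scaleE linearZl_LR /=; case: (dot _ _) => a b /=;
  rewrite mul0r addr0.
Qed.

Lemma sformZr k x y : sform x (k *: y) = k * sform x y.
Proof.
rewrite /sform realify_scaleE linearZr_LR /=.
by case: (dot _ _) => a b /=; rewrite oppr0 mul0r addr0.
Qed.

Lemma sformC x y : sform x y = - sform y x.
Proof.
rewrite /sform (hermC dot x y) expr0 mul1r.
have Im_conj (z : R[i]) : complex.Im (Num.conj z) = - complex.Im z by case: z.
exact: Im_conj.
Qed.

Lemma rnorm_sqr (x : W) : rnorm x ^+ 2 = complex.Re (dot x x).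
Proof. by rewrite -H_hilbert rnormE -rmorphXn. Qed.

(** Polarization reduces continuity of the form to continuity of the norm. *)
Lemma sform_polar x y : sform x y =
  (rnorm (x + 'i%C *: (y : H)) ^+ 2 - rnorm x ^+ 2 - rnorm y ^+ 2) / 2.
Proof.
rewrite !rnorm_sqr /sform dnormD dnormZ linearZr_LR /=.
have -> : `|'i%C : R[i]| = 1 by rewrite normc_def /= expr0n expr1n add0r sqrtr1.
rewrite expr1n mul1r; case: (dot x x) (dot y y) (dot x y) => [a b] [a' b'] [s t] /=.
by field.
Qed.

Lemma sform_real_polar x y : sform ('i%C *: (x : H) : H) y =
  (rnorm (x + y) ^+ 2 - rnorm x ^+ 2 - rnorm y ^+ 2) / 2.
Proof.
rewrite !rnorm_sqr /sform dnormD linearZl_LR /=.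
case: (dot x x) (dot y y) (dot x y) => [a b] [a' b'] [s t] /=.
by field.
Qed.

Lemma cvg_sform {T : Type} {F : set_system T} {FF : Filter F} (f g : T -> W)
  (a b : W) :
  f @ F --> a -> g @ F --> b -> sform (f t) (g t) @[t --> F] --> sform a b.
Proof.
move=> fa gb; rewrite sform_polar; under eq_fun do rewrite sform_polar.
have sq (h : T -> W) l : h @ F --> l -> rnorm (h t) ^+ 2 @[t --> F] --> rnorm
  l ^+ 2.
  by move=> /cvg_rnorm hl; under eq_fun do rewrite expr2; rewrite expr2;
    exact: cvgM.
apply: cvgM; last exact: cvg_cst.
apply: cvgB; last exact: sq.
apply: cvgB; last exact: sq.
apply: sq; apply: tvs_cvgD => //.
exact: (@tvs_cvgZl _ H).
Qed.

Lemma sform_unitary u x y : unitary_operator dot u -> sform (u x) (u y) = sform x y.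
Proof. by case=> _ ud _; rewrite /sform ud. Qed.

Lemma sform_ge0_dot x y : sform ('i%C *: (x : H) : H) y = 0 -> 0 <= sform x y ->
  0 <= dot (- 'i%C *: (x : H)) y.
Proof.
rewrite /sform linearZl_LR /= linearZl_LR /= lecE; case: (dot _ _) => a b /=.
move=> ea b0; apply/andP; split; last by lra.
by apply/eqP; lra.
Qed.

Section Unitary.
Variable u : H -> H.
Hypothesis uP : unitary_operator dot u.

Lemma unitaryD x y : u (x + y) = u x + u y.
Proof. by case: uP => ul _ _; rewrite -{1}[x]scale1r ul scale1r. Qed.

Lemma unitary0 : u 0 = 0.
Proof. by apply: (@addrI _ (u 0)); rewrite -unitaryD !addr0. Qed.

Lemma unitaryZ a x : u (a *: x) = a *: u x.
Proof. by case: uP => ul _ _; rewrite -[a *: x]addr0 ul unitary0 addr0. Qed.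

Lemma unitaryN x : u (- x) = - u x.
Proof. by rewrite -scaleN1r unitaryZ scaleN1r. Qed.

Lemma unitaryB x y : u (x - y) = u x - u y.
Proof. by rewrite unitaryD unitaryN. Qed.

Lemma unitary_sum n (f : 'I_n -> H) : u (\sum_i f i) = \sum_i u (f i).
Proof. by apply: (big_morph u); [exact: unitaryD|exact: unitary0]. Qed.

Lemma unitary_rnorm x : rnorm (u x) = rnorm x.
Proof.
case: uP => _ ud _; apply/eqP; rewrite -(eqrXn2 (n := 2)) ?rnorm_ge0 //; apply/eqP.
by apply: complexI; rewrite !rmorphXn /= -!rnormE !H_hilbert ud.
Qed.

Lemma unitary_cvg {T : Type} {F : set_system T} {FF : Filter F} (f : T -> W)
  (a : W) :
  f @ F --> a -> (u (f t) : W) @[t --> F] --> (u a : W).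
Proof.
move=> /cvg_rnormP fa; apply/cvg_rnormP => e /fa.
by apply: filterS => t; rewrite -unitaryB unitary_rnorm.
Qed.

End Unitary.

Section Generators.
Variables (K : set H) (V : R -> H -> H).

Lemma generator_cvg x : odom (generator K V) x ->
  h^-1 *: ((V h x : W) - V 0 x) @[h --> dn] --> (generator K V x : W).
Proof.
case=> _ /dderivP; apply: cvg_trans; apply: near_eq_cvg; near=> h.
by rewrite /diff_quotient addr0 [h *: 1]mulr1.
Unshelve. all: by end_near. Qed.

Lemma cvg_generator x (l : W) : K x ->
  h^-1 *: ((V h x : W) - V 0 x) @[h --> dn] --> l ->
  odom (generator K V) x /\ generator K V x = l.
Proof.
move=> Kx Vl; pose orb (t : R^o) : W := V t x.
have qE : diff_quotient orb 0 1 = fun h => h^-1 *: ((V h x : W) - V 0 x).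
  by apply/funext => h; rewrite /diff_quotient addr0 [h *: 1]mulr1.
have ol : diff_quotient orb 0 1 @ dn --> l by rewrite qE.
split; first by split=> //; exists l.
exact: dderiv_unique realify_hausdorff ol.
Qed.

End Generators.
End RealHilbert.

(** * Invariant cores of generators *)

Section Core.
Context {R : realType} {H : completeNormedModType R[i]}.
Variable dot : {dot H for Num.conj}.
Hypothesis H_hilbert : is_hilbert dot.
Local Notation dn := (0 : R)^'.
Local Notation W := (realify H).

Lemma rnorm_sum n (f : 'I_n -> W) : rnorm (\sum_i f i) <= \sum_i rnorm (f i).
Proof.
elim/big_ind2 : _ => // [|x a y b xa yb].
  by rewrite /rnorm normr0.
by apply: le_trans (rnormD _ _) _; exact: lerD.
Qed.

Lemma rnorm_average n (f : 'I_n.+1 -> W) (w : W) (m : R) :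
  (forall i, rnorm (f i - w) <= m) ->
  rnorm (n.+1%:R^-1 *: \sum_i f i - w) <= m.
Proof.
move=> fm; have n0 : n.+1%:R != 0 :> R by [].
have -> : n.+1%:R^-1 *: \sum_i f i - w = n.+1%:R^-1 *: \sum_i (f i - w).
  rewrite sumrB sumr_const card_ord scalerBr -(@scaler_nat R W).
  by rewrite [in RHS]scalerA mulVf // scale1r.
rewrite rnormZ ger0_norm // mulrC ler_pdivrMr //.
apply: le_trans (rnorm_sum _) _.
apply: le_trans (ler_sum _ (fun i _ => fm i)) _.
by rewrite sumr_const card_ord -[m *+ _]mulr_natr.
Qed.

Variables (K D : set H) (V : R -> H -> H).
Hypothesis VU : forall t, unitary_operator dot (V t).
Hypothesis V0 : forall x, V 0 x = x.
Hypothesis VD : forall s t x, V (s + t) x = V s (V t x).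
Hypothesis D0 : D 0.
Hypothesis DD : forall x y, D x -> D y -> D (x + y).
Hypothesis DZ : forall (a : R) (x : W), D x -> D (a *: x).
Hypothesis DV : forall t x, D x -> D (V t x).
Hypothesis DB : D `<=` odom (generator K V).
Local Notation B := (generator K V).

Lemma generator_cvg0 (x : H) : odom B x ->
  h^-1 *: ((V h x : W) - x) @[h --> dn] --> (B x : W).
Proof. by move/generator_cvg; rewrite V0. Qed.

(** The operators V_s commute with each other, so difference quotients pass inside the average;
    finite averages replace integrals over the orbit. *)
Lemma generator_average n (h : R) (x : H) : D x ->
  let y : W := n.+1%:R^-1 *: \sum_(k < n.+1) (V (k%:R * h) x : W) in
  D y /\ B y = n.+1%:R^-1 *: \sum_(k < n.+1) (V (k%:R * h) (B x) : W).
Proof.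
move=> Dx y.
have Dy : D y.
  by apply: DZ; elim/big_ind : _ => // k _; exact: DV.
split=> //; have [Ky _] := DB Dy.
apply: (proj2 (@cvg_generator _ _ K V y _ Ky _)).
have qE s : s^-1 *: ((V s y : W) - V 0 y) =
    n.+1%:R^-1 *: \sum_(k < n.+1) (V (k%:R * h) (s^-1 *: ((V s x : W) - x)) : W).
  rewrite V0 /y.
  have -> : (V s (n.+1%:R^-1 *: \sum_(k < n.+1) (V (k%:R * h) x : W)) : W) =
      n.+1%:R^-1 *: \sum_(k < n.+1) (V (k%:R * h) (V s x) : W).
    rewrite (unitaryZ (VU s)) (unitary_sum (VU s)); congr (_ *: _).
    by apply: eq_bigr => k _; rewrite -!VD addrC.
  rewrite -scalerBr -sumrB scalerA mulrC -scalerA scaler_sumr; congr (_ *: _).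
  apply: eq_bigr => k _; rewrite realify_scaleE (unitaryZ (VU _)).
  by rewrite (unitaryB (VU _)).
under eq_fun do rewrite qE.
apply: tvs_cvgZl; apply: tvs_cvg_sum => k.
apply: (unitary_cvg H_hilbert (VU _)).
exact: generator_cvg0 (DB Dx).
Qed.

Lemma generator_telescope n (h : R) (x : H) :
  \sum_(k < n) (V (k%:R * h) ((V h x : W) - x) : W) = (V (n%:R * h) x : W) - x.
Proof.
elim: n => [|n IH]; first by rewrite big_ord0 mul0r V0 subrr.
rewrite big_ord_recr /= IH (unitaryB (VU _)) -VD -natr1 mulrDl mul1r.
by rewrite addrC subrKA.
Qed.

(* D is a core: with x' in D close to x, approximate x by the averages
   y = N^-1 sum_(k < N) V (k T / N) x'.  By telescoping, B y is close to
   T^-1 (V T x' - x') for N large, hence to B x for T small. *)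
Lemma generator_core (x : H) (e : R) : odom B x -> closure D x -> 0 < e ->
  exists2 y, D y & rnorm (y - x : W) < e /\ rnorm ((B y : W) - B x) < e.
Proof.
move=> Bx clx e0.
have /cvg_rnormP xB := generator_cvg0 Bx.
have e4 : 0 < e / 4 by rewrite divr_gt0.
have [d1 d10 xd1] : exists2 d : R, 0 < d & forall h, `|h| < d -> h != 0 ->
    rnorm (h^-1 *: ((V h x : W) - x) - (B x : W)) < e / 4.
  have /nbhs_ballP[d /= d0 dB] := xB _ e4.
  by exists d => // h hd h0; apply: dB => //; rewrite /ball /= sub0r normrN.
(* For s < d2 the difference quotient has norm below |B x| + e / 4, so V_s x moves x by less than e
   / 2. *)
pose d2 := e / 2 / (rnorm (B x : W) + e / 4).
have Bx0 := rnorm_ge0 (B x : W).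
have d20 : 0 < d2 by rewrite !divr_gt0 //; lra.
pose T : R := Num.min d1 d2 / 2.
have T0 : 0 < T by rewrite divr_gt0 // lt_min d10.
have Td1 : T < d1.
  by rewrite ltr_pdivrMr // gt_min; apply/orP; left; lra.
have Td2 : T < d2.
  by rewrite ltr_pdivrMr // gt_min; apply/orP; right; lra.
have xd2 s : 0 <= s <= T -> rnorm ((V s x : W) - x) < e / 2.
  case/andP; rewrite le_eqVlt => /predU1P[<- _|s0 sT].
    by rewrite V0 subrr /rnorm normr0 /= divr_gt0.
  have := xd1 s;
    rewrite ger0_norm ?(ltW s0) // => /(_ (le_lt_trans sT Td1) (lt0r_neq0 s0)).
  set v := s^-1 *: _ => vB.
  have -> : (V s x : W) - x = s *: v by rewrite scalerA mulfV ?scale1r // gt_eqF.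
  rewrite rnormZ gtr0_norm //.
  have vn : rnorm v < rnorm (B x : W) + e / 4.
    by have := rnormD (v - B x) (B x); rewrite subrK; lra.
  have v0 := rnorm_ge0 v.
  have := le_lt_trans sT Td2; rewrite /d2 ltr_pdivlMr; last lra.
  by apply: le_lt_trans; rewrite ler_wpM2l ?(ltW s0) // ltW.
(* The bound e / 2 controls y - x. The bound T * (e / 8) serves [step2], where twice the error x' -
   x is divided by T; hence T is fixed before x'. *)
pose e' : R := Num.min (e / 2) (T * (e / 8)).
have e'0 : 0 < e' by rewrite lt_min divr_gt0 //= mulr_gt0 // divr_gt0.
have [x' [Dx' xx']] : exists x', D x' /\ rnorm (x' - x : W) < e'.
  have nx : nbhs (x : W) [set y : W | rnorm (y - x) < e'].
    exact: (iffLR (cvg_rnormP id (x : W)) cvg_id e' e'0).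
  by have [y [Dy yx]] := clx _ nx; exists y.
have xx'1 : rnorm (x' - x : W) < e / 2 by move: xx'; rewrite lt_min => /andP[].
have xx'2 : rnorm (x' - x : W) < T * (e / 8) by move: xx';
  rewrite lt_min => /andP[].
have /cvg_rnormP/(_ _ e4)/nbhs_ballP[d3 /= d30 xd3] := generator_cvg0 (DB Dx').
(* The mesh T / (n + 1) must be below [d3], which depends on x' and is therefore known only now. *)
pose n := Num.bound (T / d3).
have Tn : T / d3 < n.+1%:R.
  apply: le_lt_trans (_ : n%:R < _); last by rewrite ltr_nat.
  by rewrite ltW // archi_boundP // divr_ge0 ?ltW.
pose h := T / n.+1%:R.
have n0 : 0 < n.+1%:R :> R by [].
have h0 : 0 < h by rewrite divr_gt0.
have hd3 : h < d3 by rewrite /h ltr_pdivrMr // mulrC -ltr_pdivrMr.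
have nh : n.+1%:R * h = T by rewrite /h mulrC divfK // gt_eqF.
have [] := generator_average n h Dx'.
set y : W := _ *: _ => Dy By; exists y => //; split.
  have : rnorm (y - x : W) <= rnorm (x' - x : W) + e / 2; last lra.
  apply: rnorm_average => k.
  have kT : 0 <= k%:R * h <= T.
    rewrite mulr_ge0 ?(ltW h0) //= -nh ler_pM2r // ler_nat.
    exact: ltnW.
  apply: le_trans (rnormB_trans (V (k%:R * h) x : W) _ _) _.
  rewrite lerD // ?(ltW (xd2 _ kT)) //.
  by rewrite -(unitaryB (VU _)) (unitary_rnorm H_hilbert (VU _)).
have step1 : rnorm ((B y : W) - T^-1 *: ((V T x' : W) - x')) <= e / 4.
  rewrite By.
  have -> : n.+1%:R^-1 *: \sum_(k < n.+1) (V (k%:R * h) (B x') : W)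
      - T^-1 *: ((V T x' : W) - x') =
    n.+1%:R^-1 *: (\sum_(k < n.+1)
      (V (k%:R * h) ((B x' : W) - h^-1 *: ((V h x' : W) - x')) : W)) - 0.
    have -> : T^-1 *: ((V T x' : W) - x') = n.+1%:R^-1 *:
        \sum_(k < n.+1) (V (k%:R * h) (h^-1 *: ((V h x' : W) - x')) : W).
      rewrite -[in LHS]nh -generator_telescope invfM -scalerA scaler_sumr.
      congr (_ *: _); apply: eq_bigr => k _.
      by rewrite realify_scaleE -(unitaryZ (VU _)).
    rewrite -scalerBr -sumrB subr0; congr (_ *: _); apply: eq_bigr => k _.
    by rewrite (unitaryB (VU _)).
  apply: rnorm_average => k; rewrite subr0 (unitary_rnorm H_hilbert (VU _)).
  rewrite rnormB ltW //; apply: xd3; last by rewrite gt_eqF.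
  by rewrite /ball /= sub0r normrN gtr0_norm.
have step2 : rnorm (T^-1 *: ((V T x' : W) - x') - T^-1 *: ((V T x : W) - x))
  <= e / 4.
  rewrite -scalerBr rnormZ gtr0_norm ?invr_gt0 // mulrC ler_pdivrMr //.
  have -> : (V T x' : W) - x' - ((V T x : W) - x) = (V T (x' - x) : W) - (x' -
    x : W).
    by rewrite (unitaryB (VU _)) opprD addrACA -opprD opprB.
  have := rnormD (V T (x' - x) : W) (- (x' - x : W)).
  by rewrite rnormN (unitary_rnorm H_hilbert (VU _)); lra.
have step3 : rnorm (T^-1 *: ((V T x : W) - x) - B x) < e / 4.
  by apply: xd1; rewrite ?gt_eqF // gtr0_norm.
have := rnormB_trans (T^-1 *: ((V T x' : W) - x')) (B y) (B x).
have := rnormB_trans (T^-1 *: ((V T x : W) - x)) (T^-1 *: ((V T x' : W) - x'))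
  (B x).
lra.
Qed.

(** With q the difference quotient, the equality of norms |x + h q| = |x| gives Re <q, x> = - (h /
    2) |q|^2, which tends to 0. *)
Lemma generator_skew (x : H) : odom B x -> sform dot ('i%C *: (B x : H) : H) x = 0.
Proof.
move=> Bx; have xB := generator_cvg0 Bx.
pose q h : W := h^-1 *: ((V h x : W) - x).
have qE h : h != 0 -> sform dot ('i%C *: (q h : H) : H) x =
    - (h / 2) * (rnorm (q h) * rnorm (q h)).
  move=> h0; have Vx : (V h x : W) = h *: q h + x.
    by rewrite scalerA mulfV // scale1r subrK.
  have := sform_real_polar H_hilbert (h *: q h) x.
  rewrite -Vx (unitary_rnorm H_hilbert (VU _)) rnormZ exprMn real_normK
    ?num_real //.
  have -> : sform dot ('i%C *: (h *: q h : H) : H) x =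
      h * sform dot ('i%C *: (q h : H) : H) x.
    by rewrite realify_scaleE scalerA mulrC -scalerA -sformZl.
  move=> e; apply: (mulfI h0); rewrite e; by field.
have l1 : sform dot ('i%C *: (q h : H) : H) x @[h --> dn] -->
    sform dot ('i%C *: (B x : H) : H) x.
  by apply: (cvg_sform H_hilbert); [exact: (@tvs_cvgZl _ H)|exact: cvg_cst].
have l2 : - (h / 2) * (rnorm (q h) * rnorm (q h)) @[h --> dn] -->
    - (0 / 2) * (rnorm (B x : W) * rnorm (B x : W)).
  apply: cvgM; last by apply: cvgM; exact: cvg_rnorm.
  apply: cvgN; apply: cvgM; last exact: cvg_cst.
  by apply: cvg_within_filter; exact: cvg_id.
rewrite mul0r oppr0 mul0r in l2.
have l3 : sform dot ('i%C *: (q h : H) : H) x @[h --> dn] --> (0 : R).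
  apply: cvg_trans l2; apply: near_eq_cvg; near=> k.
  have k0 : k != 0 by near: k; exact: nbhs_dnbhs_neq.
  by rewrite qE.
exact: (cvg_unique (@Rhausdorff R) l1 l3).
Unshelve. all: by end_near. Qed.

(** Telescoping over N steps of length t / N bounds |V_t x - x| by |t| times the norm of one
    difference quotient, which tends to B x = 0. *)
Lemma generator_fixed (x : H) : odom B x -> B x = 0 -> forall t, V t x = x.
Proof.
move=> Bx Bx0 t; apply/eqP; rewrite -subr_eq0 -normr_eq0; apply/eqP.
rewrite (rnormE (V t x - x : W)); suff -> : rnorm (V t x - x : W) = 0 by [].
apply/eqP; rewrite eq_le rnorm_ge0 andbT; apply/ler_addgt0Pr => e e0; rewrite add0r.
have [->|t0] := eqVneq t 0; first by rewrite V0 subrr /rnorm normr0 ltW.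
have et : 0 < e / `|t| by rewrite divr_gt0 ?normr_gt0.
have /cvg_rnormP/(_ _ et)/nbhs_ballP[d /= d0 xd] := generator_cvg0 Bx.
pose n := Num.bound (`|t| / d).
have tn : `|t| / d < n.+1%:R.
  apply: le_lt_trans (_ : n%:R < _); last by rewrite ltr_nat.
  by rewrite ltW // archi_boundP // divr_ge0 // ltW.
pose h := t / n.+1%:R.
have n0 : n.+1%:R != 0 :> R by [].
have h0 : h != 0 by rewrite mulf_neq0 // invr_neq0.
have nh : n.+1%:R * h = t by rewrite /h mulrC divfK.
have hd : `|h| < d.
  by rewrite normrM normfV normr_nat ltr_pdivrMr // mulrC -ltr_pdivrMr.
have : rnorm (h^-1 *: ((V h x : W) - x) - (B x : W)) < e / `|t|.
  by apply: xd => //; rewrite /ball /= sub0r normrN.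
rewrite Bx0 subr0 rnormZ normfV.
rewrite mulrC ltr_pdivrMr ?normr_gt0 // => hx.
rewrite -nh -generator_telescope; apply: le_trans (rnorm_sum _) _.
apply: le_trans (ler_sum (G := fun=> e / `|t| * `|h|) _ _) _.
  by move=> k _; rewrite (unitary_rnorm H_hilbert (VU _)) ltW.
have ht : `|h| * n.+1%:R = `|t| by rewrite -[in RHS]nh [in RHS]normrM
  normr_nat mulrC.
rewrite sumr_const card_ord -(mulr_natr (e / `|t| * `|h|)) -mulrA ht divfK //.
by rewrite normr_eq0.
Qed.

(** Approximation holds in the graph norm, so both arguments of the form converge and the sign
    survives. *)
Lemma generator_sform_ge0 (x : H) : odom B x -> closure D x ->
  (forall y, D y -> 0 <= sform dot (B y) y) -> 0 <= sform dot (B x) x.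
Proof.
move=> Bx clx Dge0.
have /choice[f fP] : forall n : nat, exists y : H, D y /\
    (rnorm (y - x : W) < n.+1%:R^-1 /\ rnorm ((B y : W) - B x) < n.+1%:R^-1).
  move=> n; have [|y Dy yx] := @generator_core x n.+1%:R^-1 Bx clx.
    by rewrite invr_gt0.
  by exists y.
have fx : (f n : W) @[n --> \oo] --> (x : W).
  apply/cvg_rnormP => e e0; have := near_infty_natSinv_lt (PosNum e0).
  by apply: filterS => n /=; apply: lt_trans; have [_ []] := fP n.
have Bfx : (B (f n) : W) @[n --> \oo] --> (B x : W).
  apply/cvg_rnormP => e e0; have := near_infty_natSinv_lt (PosNum e0).
  by apply: filterS => n /=; apply: lt_trans; have [_ []] := fP n.
apply: (cvgr_to_ge (cvg_sform H_hilbert Bfx fx)).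
by apply: nearW => n; apply: Dge0; have [] := fP n.
Qed.

End Core.

(** * Ground state representations *)

Lemma closure_ge0 {R : realType} {X : topologicalType} (f : X -> R) (S : set
  X) y : continuous f ->
  (forall z, S z -> 0 <= f z) -> closure S y -> 0 <= f y.
Proof.
move=> fc Sf Sy; rewrite leNgt; apply/negP => fy.
have ny : nbhs y (f @^-1` [set r | r < 0]).
  by apply: fc; apply: open_nbhs_nbhs; split => //; exact: open_lt.
by have [z [Sz /= fz]] := Sy _ ny; have := Sf z Sz; rewrite leNgt fz.
Qed.

(** * Derivatives of orbit maps *)

Section OrbitDerivative.
Context {R : realType} {E : tvsType R} {G : pretopologicalGroupType}.
Variable L : lieGroup E G.
Context {H : completeNormedModType R[i]}.
Variable dot : {dot H for Num.conj}.
Hypothesis H_hilbert : is_hilbert dot.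
Variable pi : G -> H -> H.
Hypothesis piP : unitary_rep dot *%g 1%g pi.
Local Notation dn := (0 : R)^'.
Local Notation W := (realify H).
Local Notation c := (lg_one L).

(* T x = d pi(x) xi; all that is used of a smooth vector is the existence of
   such a strict derivative, and this class of vectors is plainly pi-invariant. *)
Definition orbit_deriv (xi : H) (T : E -> W) : Prop :=
  strict_deriv c (fun g => pi g xi : W) 1%g T /\ continuous T.

Lemma pi_unitary g : unitary_operator dot (pi g).
Proof. by case: piP. Qed.

Lemma pi1 x : pi 1%g x = x.
Proof. by case: piP. Qed.

Lemma piM g h x : pi (g * h)%g x = pi g (pi h x).
Proof. by case: piP. Qed.

Lemma smooth_orbit_deriv xi : smooth_vectors L pi xi -> exists T, orbit_deriv xi T.
Proof.
move=> sxi; have [Ac c1] := lg_oneP L; eexists.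
exact: (smooth_map_strict (a := 1%g) sxi Ac
  (erefl : tvs_atlas W (Chart setT id id)) (lg_one_chart L) openT c1 I).
Qed.

Lemma orbit_deriv_add xi eta T S : orbit_deriv xi T -> orbit_deriv eta S ->
  orbit_deriv (xi + eta) (fun x => T x + S x).
Proof.
move=> [Td Tc] [Sd Sc]; split=> [r p q w r0 p1 q1 pq|x].
  have := tvs_cvgD (Td r p q w r0 p1 q1 pq) (Sd r p q w r0 p1 q1 pq).
  under eq_fun do rewrite -scalerDr addrACA -opprD -!(unitaryD (pi_unitary _)).
  by move=> h; exact: h.
by apply: tvs_cvgD; [exact: Tc|exact: Sc].
Qed.

Lemma orbit_deriv_scale (k : R) (xi : W) T : orbit_deriv xi T ->
  orbit_deriv (k *: xi) (fun x => k *: T x).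
Proof.
move=> [Td Tc]; split=> [r p q w r0 p1 q1 pq|x]; last by apply: tvs_cvgZl;
  exact: Tc.
have := tvs_cvgZl (k := k) (Td r p q w r0 p1 q1 pq).
have e h : k *: ((r h)^-1 *: ((pi (p h) xi : W) - pi (q h) xi)) =
    (r h)^-1 *: ((pi (p h) (k *: xi) : W) - pi (q h) (k *: xi)).
  rewrite scalerA mulrC -scalerA scalerBr realify_scaleE.
  by rewrite !(unitaryZ (pi_unitary _)).
under eq_fun do rewrite e.
by move=> h; exact: h.
Qed.

(** Since pi(x) pi(g) xi = pi(g) pi(g^-1 x g) xi, the derivative is pi(g) T Ad(g^-1). *)
Lemma orbit_deriv_pi g xi T : orbit_deriv xi T -> exists S, orbit_deriv (pi g xi) S.
Proof.
move=> [Td Tc]; have [Ad [Ad_strict Ad_cont]] := strict_conj L g.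
have Td1 : strict_deriv c (fun g => pi g xi : W) (g^-1 * 1 * g)%g T.
  by rewrite mulg1 mulVg.
have cj : {for 1%g, continuous (fun x => (g^-1 * x * g)%g)}.
  by apply: (lg_cvg_mul L); [apply: (lg_cvg_mul L);
    [exact: cvg_cst|exact: cvg_id]|exact: cvg_cst].
have Sd := strict_deriv_comp cj Ad_strict Td1.
exists (fun x => pi g (T (Ad x))); split=> [r p q w r0 p1 q1 pq|x].
  have := unitary_cvg H_hilbert (pi_unitary g) (Sd r p q w r0 p1 q1 pq).
  have e h : (pi g ((r h)^-1 *: ((pi (g^-1 * p h * g)%g xi : W) - pi (g^-1 * q
    h * g)%g xi)) : W)
     = (r h)^-1 *: ((pi (p h) (pi g xi) : W) - pi (q h) (pi g xi)).
    rewrite realify_scaleE (unitaryZ (pi_unitary _)) (unitaryB (pi_unitary _)).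
    by rewrite -!piM !mulgA mulgV !mul1g.
  under eq_fun do rewrite /= e.
  by move=> h; exact: h.
apply: (unitary_cvg H_hilbert (pi_unitary g)).
exact: (cvg_comp _ _ (Ad_cont x) (Tc (Ad x))).
Qed.

Section OneVector.
Variables (xi : H) (T : E -> W).
Hypothesis xiT : orbit_deriv xi T.

Lemma orbit_derivD : {morph T : x y / x + y}.
Proof.
exact: (strict_derivD (lg_one_chart L) (@realify_hausdorff _ _) (lg_one_dom L)
  (proj1 xiT)).
Qed.

Lemma orbit_derivZ k x : T (k *: x) = k *: T x.
Proof.
exact: (strict_derivZ (lg_one_chart L) (@realify_hausdorff _ _) (lg_one_dom L)
  (proj1 xiT)).
Qed.

Lemma orbit_deriv_curve (p : R -> G) x : p h @[h --> dn] --> 1%g ->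
  h^-1 *: (c (p h) - c 1%g) @[h --> dn] --> x ->
  h^-1 *: ((pi (p h) xi : W) - xi) @[h --> dn] --> T x.
Proof.
move=> p1 px; have := proj1 xiT id p (fun=> 1%g) x.
rewrite pi1; apply => //; first exact: nbhs_dnbhs_neq.
exact: cvg_cst.
Qed.

Lemma orbit_deriv_exp x :
  h^-1 *: ((pi (lg_exp L (h *: x)) xi : W) - xi) @[h --> dn] --> T x.
Proof. by apply: orbit_deriv_curve; [exact: lg_exp_cvg|exact: lg_exp_strict]. Qed.

(* Both sides are the second order term at s = 0 of
   <pi(exp sx exp sy) xi - pi(exp sy exp sx) xi, xi>. *)
Lemma sform_bracket x y :
  sform dot (T (bracket L x y)) xi = 2 * sform dot (T x) (T y).
Proof.
pose p z (h : R) := lg_exp L (h *: z).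
have p1 z : p z h @[h --> dn] --> 1%g by exact: lg_exp_cvg.
pose d z h : W := (pi (p z h) xi : W) - xi.
have dE z h : (pi (p z h) xi : W) = xi + d z h by rewrite addrC subrK.
have dT z : h^-1 *: d z h @[h --> dn] --> T z by exact: orbit_deriv_exp.
have pq1 z w : (p z h * p w h)%g @[h --> dn] --> 1%g.
  by rewrite -(mulg1 1%g); exact: (lg_cvg_mul L).
have s0 : sform dot xi xi = 0 by have := sformC dot xi xi; lra.
have pV z h v : sform dot (pi (p z h) v) xi = sform dot v (pi (p (- z) h) xi).
  rewrite -[in LHS](pi1 xi) -[1%g](mulgV (p z h)) piM.
  by rewrite (sform_unitary _ _ (pi_unitary _)) /p scalerN lg_expN.
have ds z h : sform dot xi (d (- z) h) = sform dot (d z h) xi.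
  by rewrite /d sformDl sformDr pV sformNl sformNr s0.
clearbody d.
(* The first order terms are symmetric in z and w. Exchanging the factors and subtracting thus
   leaves only products of two increments, which rescale to rate h^2. *)
have sp z w h : sform dot (pi (p z h * p w h)%g xi) xi =
    sform dot (d w h) (d (- z) h) + sform dot (d w h) xi + sform dot (d z h) xi.
  by rewrite piM pV !dE !sformDl !sformDr s0 ds; lra.
have lim1 : sform dot (h ^- 2 *: ((pi (p x h * p y h)%g xi : W)
     - pi (p y h * p x h)%g xi)) xi @[h --> dn] --> sform dot (T (bracket L x
       y)) xi.
  apply: (cvg_sform H_hilbert); last exact: cvg_cst.
  (* The strict derivative is used at rate h^2 between the two orders of multiplication, both of
     which move with h. *)
  apply: (proj1 xiT (fun h => h ^+ 2)) => //.
    near=> h; have h0 : h != 0 by near: h; exact: nbhs_dnbhs_neq.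
    by rewrite expf_neq0.
  by apply: bracket_cvg => //; exact: lg_exp_strict.
have lim2 : sform dot (h^-1 *: d y h) (h^-1 *: d (- x) h)
    - sform dot (h^-1 *: d x h) (h^-1 *: d (- y) h) @[h --> dn] -->
    sform dot (T y) (T (- x)) - sform dot (T x) (T (- y)).
  by apply: cvgB; apply: (cvg_sform H_hilbert); exact: dT.
have TN z : T (- z) = - T z by rewrite -scaleN1r orbit_derivZ scaleN1r.
have {lim2} : sform dot (h ^- 2 *: ((pi (p x h * p y h)%g xi : W)
     - pi (p y h * p x h)%g xi)) xi @[h --> dn] --> 2 * sform dot (T x) (T y).
  have -> : 2 * sform dot (T x) (T y) =
      sform dot (T y) (T (- x)) - sform dot (T x) (T (- y)).
    by rewrite !TN !sformNr (sformC dot (T y)); lra.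
  apply: cvg_trans lim2; apply: near_eq_cvg; near=> h.
  rewrite !sformZl !sformZr sformDl sformNl !sp -exprVn; ring.
move=> lim2; exact: (cvg_unique (@Rhausdorff R) lim1 lim2).
Unshelve. all: by end_near. Qed.

End OneVector.

(** * Covariance and positivity at ground vectors *)

Section PositiveEnergy.
Variables (alpha : R -> G -> G) (U : R -> H -> H) (A : @operator R H).
Hypothesis alphaP : smooth_action L alpha.
Hypothesis piU : positive_energy_rep dot alpha pi U A.

Lemma U_unitary t : unitary_operator dot (U t).
Proof. by case: piU => _ []. Qed.

Lemma U0 x : U 0 x = x.
Proof. by case: piU => _ []. Qed.

Lemma UD s t x : U (s + t) x = U s (U t x).
Proof. by case: piU => _ []. Qed.

Lemma energy_generator x (l : H) :
  h^-1 *: ((U h x : W) - x) @[h --> dn] --> (l : W) ->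
  odom A x /\ l = 'i%C *: A x.
Proof.
move=> Ul; case: piU => _ _ _ [domA genA] _.
have [] := @cvg_generator _ _ setT U x l I; first by rewrite U0.
by move=> dx <-; split; [rewrite -[odom A]domA|exact: genA].
Qed.

(** Being fixed by [U] is the form in which covariance can be applied, and it makes stability under
    the fixed point group immediate. *)
Lemma ker_energyP x : ker A x <-> forall t, U t x = x.
Proof.
split=> [[dx Ax0]|Ux].
  case: piU => _ _ _ [domA genA] _.
  have dx' : odom (generator setT U) x by rewrite domA.
  apply: (generator_fixed H_hilbert U_unitary U0 UD dx').
  by rewrite genA //= Ax0 scaler0.
have [|dx /esym/eqP] := @energy_generator x 0.
  under eq_fun do rewrite Ux subrr scaler0; exact: cvg_cst.
rewrite scaler_eq0 => /orP[|/eqP Ax0]; last by split.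
by rewrite eq_complex /= oner_eq0 andbF.
Qed.

Lemma pi_alpha t g x : U t (pi g x) = pi (alpha t g) (U t x).
Proof.
case: piU => _ _ _ _ cov.
by rewrite -cov -UD addNr U0.
Qed.

Lemma ker_energy_fixed g x : fixed_group alpha g -> ker A x -> ker A (pi g x).
Proof.
move=> fg /ker_energyP Ux; apply/ker_energyP => t.
by rewrite pi_alpha fg Ux.
Qed.

Section OneGroundVector.
Variables (xi : H) (T : E -> W).
Hypothesis xi_ker : ker A xi.
Hypothesis xiT : orbit_deriv xi T.

(** Only the velocity of the curve alpha_t(exp(h x)) enters, so it need not be rewritten as a
    one-parameter group. *)
Lemma U_orbit_deriv t x : U t (T x) = T (lie_action L alpha t x).
Proof.
have [as_ _] := lie_action_strict alphaP t.
have p1 := lg_exp_cvg L x; have px := @lg_exp_strict _ _ _ L x.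
have aq : alpha t (lg_exp L (h *: x)) @[h --> dn] --> 1%g.
  case: (alphaP) => _ _ _ [ac _].
  rewrite -(action1 alphaP t).
  apply: (cvg_comp (fun h => (t, lg_exp L (h *: x))) (fun z : R^o * G => alpha
    z.1 z.2) _ (ac (t, 1%g))).
  by apply: (@cvg_pair _ _ _ _ (nbhs (t : R^o))) => //; exact: cvg_cst.
have ax : h^-1 *: (c (alpha t (lg_exp L (h *: x))) - c 1%g) @[h --> dn] -->
    lie_action L alpha t x.
  rewrite -[in c 1%g](action1 alphaP t).
  apply: (as_ id _ (fun=> 1%g)) => //; first exact: nbhs_dnbhs_neq.
  exact: cvg_cst.
have l1 := orbit_deriv_curve xiT aq ax.
have := unitary_cvg H_hilbert (U_unitary t) (orbit_deriv_curve xiT p1 px).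
have e h : (U t (h^-1 *: ((pi (lg_exp L (h *: x)) xi : W) - xi)) : W) =
    h^-1 *: ((pi (alpha t (lg_exp L (h *: x))) xi : W) - xi).
  rewrite realify_scaleE (unitaryZ (U_unitary t)) (unitaryB (U_unitary t)).
  by rewrite pi_alpha (iffLR (ker_energyP xi)).
under eq_fun do rewrite e.
move=> l2; exact: (cvg_unique (@realify_hausdorff _ _) (l2 _) l1).
Qed.

Lemma U_orbit_deriv_cvg x :
  h^-1 *: ((U h (T x) : W) - T x) @[h --> dn] --> T (action_derivation L alpha x).
Proof.
have l := cvg_comp _ _ (@action_derivation_cvg _ _ _ L alpha alphaP x)
  (proj2 xiT (action_derivation L alpha x)).
apply: cvg_trans l; apply: near_eq_cvg; near=> h => /=.
by rewrite (orbit_derivZ xiT) (orbit_derivD xiT) -scaleN1r (orbit_derivZ xiT)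
  scaleN1r U_orbit_deriv.
Unshelve. all: by end_near. Qed.

Lemma sform_derivation_ge0 x :
  0 <= sform dot (T (action_derivation L alpha x)) (T x).
Proof.
have [dx ->] := energy_generator (@U_orbit_deriv_cvg x).
case: piU => _ _ [_ Apos] _ _; have := Apos _ dx.
rewrite /sform linearZl_LR /= lecE; case: (dot _ _) => a b /= /andP[_ a0].
by lra.
Qed.

(** The pairing of U_h T x with xi = U_h xi does not depend on h, because U_h is unitary. *)
Lemma sform_range_derivation x : sform dot (T (action_derivation L alpha x)) xi = 0.
Proof.
have l : sform dot (h^-1 *: ((U h (T x) : W) - T x)) xi @[h --> dn] -->
    sform dot (T (action_derivation L alpha x)) xi.
  by apply: (cvg_sform H_hilbert); [exact: U_orbit_deriv_cvg|exact: cvg_cst].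
have l0 : sform dot (h^-1 *: ((U h (T x) : W) - T x)) xi @[h --> dn] --> (0 : R).
  apply: cvg_trans (@cvg_cst _ (0 : R) _ dn _); apply: near_eq_cvg; near=> h.
  rewrite sformZl sformDl sformNl -{1}(iffLR (ker_energyP xi) xi_ker h).
  by rewrite (sform_unitary _ _ (U_unitary h)) subrr mulr0.
exact: (cvg_unique (@Rhausdorff R) l l0).
Unshelve. all: by end_near. Qed.

Lemma continuous_sform_orbit : continuous (fun y => sform dot (T y) xi).
Proof.
by move=> y; apply: (cvg_sform H_hilbert); [exact: (proj2 xiT)|exact: cvg_cst].
Qed.

Lemma sform_g_plus y : g_plus L alpha y -> sform dot (T y) xi = 0.
Proof.
move=> gy; apply/eqP; rewrite eq_le -oppr_ge0; apply/andP; split.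
  apply: (closure_ge0 (f := fun y => - sform dot (T y) xi)) gy.
    by move=> z; apply: cvgN; exact: continuous_sform_orbit.
  by move=> _ [x _ <-]; rewrite sform_range_derivation oppr0.
apply: closure_ge0 continuous_sform_orbit _ gy.
by move=> _ [x _ <-]; rewrite sform_range_derivation.
Qed.

Variable p0 : E -> E.
Hypothesis p0P : projection_along (fixed_algebra L alpha) (g_plus L alpha) p0.

Lemma sform_C_alpha_ge0 z : C_alpha L alpha p0 z -> 0 <= sform dot (T z) xi.
Proof.
move=> zC; apply: (closure_ge0 continuous_sform_orbit _ zC).
move=> _ [n [a [v [a0 _ vS ->]]]].
have -> : sform dot (T (\sum_i a i *: v i)) xi = \sum_i a i * sform dot (T (v
  i)) xi.
  elim/big_ind2 : _ => [|x s y t <- <-|i _].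
  - by have := orbit_derivZ xiT 0 0; rewrite !scale0r => ->;
    rewrite -(scale0r (0 : W)) sformZl mul0r.
  - by rewrite (orbit_derivD xiT) sformDl.
  - by rewrite (orbit_derivZ xiT) sformZl.
apply: sumr_ge0 => i _; apply: mulr_ge0 => //.
have [x _ <-] := vS i.
set b := bracket _ _ _.
(* The difference b - p0 b lies in g_+, which pairs to zero with xi. *)
have -> : sform dot (T (p0 b)) xi = sform dot (T b) xi.
  rewrite -[in RHS](subrK (p0 b) b) (orbit_derivD xiT) sformDl.
  rewrite [X in _ = X + _]sform_g_plus ?add0r //.
  by have [] := p0P b.
by rewrite (sform_bracket xiT) mulr_ge0 // sform_derivation_ge0.
Qed.

End OneGroundVector.
End PositiveEnergy.
End OrbitDerivative.

(** The values of [p0] lie in a closed subspace, which absorbs hull and closure. Elements of the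
    cone can thus be lifted to the Lie algebra of the fixed point group. *)
Lemma C_alpha_fixed (R : realType) (E : tvsType R) (G : pretopologicalGroupType)
    (L : lieGroup E G) (alpha : R -> G -> G) (p0 : E -> E) :
  smooth_action L alpha ->
  projection_along (fixed_algebra L alpha) (g_plus L alpha) p0 ->
  C_alpha L alpha p0 `<=` fixed_algebra L alpha.
Proof.
move=> aP pP; rewrite [X in _ `<=` X](closure_id _).1;
  last exact: fixed_algebra_closed.
apply: closure_subset => _ [n [a [v [_ _ vS ->]]]].
apply: fixed_algebra_comb => // i.
by have [x _ <-] := vS i; have [] := pP (bracket L (action_derivation L alpha x) x).
Qed.

Theorem theorem3p11 (R : realType)
  (* G is a Lie group modeled on the locally convex space E *)
  (E : tvsType R) (G : pretopologicalGroupType) (L : lieGroup E G)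
  (* alpha is a smooth R-action by automorphisms *)
  (alpha : R -> G -> G) (alpha_smooth : smooth_action L alpha)
  (* the fixed point group is a Lie group with Lie algebra g^0 *)
  (E0 : tvsType R) (G0 : pretopologicalGroupType) (L0 : lieGroup E0 G0)
  (iota : G0 -> G) (G0_fixed : fixed_lie_group L alpha L0 iota)
  (* g = g^0 (+) g_+ as topological vector spaces *)
  (g_split : top_direct_sum (fixed_algebra L alpha) (g_plus L alpha))
  (p0 : E -> E)
  (p0_proj : projection_along (fixed_algebra L alpha) (g_plus L alpha) p0)
  (* the smooth ground state representation *)
  (H : completeNormedModType R[i]) (dot : {dot H for Num.conj})
  (H_hilbert : is_hilbert dot)
  (pi : G -> H -> H) (U : R -> H -> H) (A : @operator R H)
  (pi_ground : smooth_ground_state_rep dot L alpha pi U A) :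
  C_alpha L alpha p0 `<=`
    lie_map L0 L iota @` positive_cone dot L0 (ker A) (pi \o iota).
Proof.
move=> z zC.
have [[piU _] dense] := pi_ground.
have piP : unitary_rep dot *%g 1%g pi by case: piU.
have [iotaM [_ iota_range] iota_smooth [_ lie_range] _] := G0_fixed.
have [z0 _ z0E] : range (lie_map L0 L iota) z.
  by rewrite lie_range; exact: C_alpha_fixed zC.
exists z0 => //.
have iota1 : iota 1%g = 1%g.
  by apply: (@mulIg _ (iota 1%g)); rewrite -iotaM !mul1g.
(* The one-parameter group comes from [G0] and need not be compared with exponentials in [G]: strict
   derivatives see only its velocity z at 1. *)
pose g t := iota (lg_exp L0 (t *: z0)).
have gfix t : fixed_group alpha (g t).
  by rewrite -iota_range; exists (lg_exp L0 (t *: z0)).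
have g1 : g h @[h --> (0 : R)^'] --> 1%g.
  rewrite -iota1; case: iota_smooth => ic _.
  exact: (cvg_comp _ _ (lg_exp_cvg L0 z0) (ic 1%g)).
have gz : h^-1 *: (lg_one L (g h) - lg_one L 1%g) @[h --> (0 : R)^'] --> z.
  have [st _] := lie_map_strict iota_smooth iota1.
  rewrite -z0E -[in lg_one L 1%g]iota1.
  apply: (st id _ (fun=> 1%g)); first exact: nbhs_dnbhs_neq.
  - exact: lg_exp_cvg.
  - exact: cvg_cst.
  - exact: lg_exp_strict.
pose V t := pi (g t).
pose D := [set xi | ker A xi /\ exists T, orbit_deriv L pi xi T].
have kerP := ker_energyP H_hilbert piU.
have UU := U_unitary piU.
have VU t : unitary_operator dot (V t) by exact: pi_unitary.
have V0 x : V 0 x = x by rewrite /V /g scale0r lg_exp0 iota1 (pi1 piP).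
have VD s t x : V (s + t) x = V s (V t x).
  by rewrite /V /g lg_exp_add iotaM (piM piP).
have DD x y : D x -> D y -> D (x + y).
  move=> [/kerP kx [T xT]] [/kerP ky [S yS]]; split.
    by apply/kerP => t; rewrite (unitaryD (UU t)) kx ky.
  by exists (fun x => T x + S x); exact: (orbit_deriv_add piP).
have DZ (a : R) (x : realify H) : D x -> D (a *: x).
  move=> [/kerP kx [T xT]]; split.
    by apply/kerP => t; rewrite realify_scaleE (unitaryZ (UU t)) kx.
  by exists (fun x => a *: T x); exact: (orbit_deriv_scale piP).
have DV t x : D x -> D (V t x).
  move=> [kx [T xT]]; split; first exact: (ker_energy_fixed H_hilbert piU).
  exact: (orbit_deriv_pi H_hilbert piP (g t) xT).
have Dgen x T : ker A x -> orbit_deriv L pi x T ->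
    odom (generator (ker A) V) x /\ generator (ker A) V x = T z.
  move=> kx xT; apply: cvg_generator => //; rewrite V0.
  exact: (orbit_deriv_curve piP xT).
have DB : D `<=` odom (generator (ker A) V).
  by move=> x [kx [T xT]]; have [] := Dgen x T kx xT.
have smD : ker A `&` smooth_vectors L pi `<=` D.
  by move=> x [kx sx]; split=> //; exact: smooth_orbit_deriv.
have kD : ker A `<=` closure D.
  by move=> x /dense; exact: (closure_subset smD).
move=> x xdom; have [kx _] := xdom; have clx := kD x kx.
(* That [D] is nonempty is read off from its closure containing x; scaling an element by 0 does the
   rest. *)
have D0 : D 0.
  have [y [Dy _]] := clx _ (filterT : nbhs x setT).
  by rewrite -(scale0r (y : realify H)); exact: DZ.
(* The order on [R[i]] demands a real value as well as its sign: skewness gives the former, the core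
   argument the latter. *)
apply: (@sform_ge0_dot _ _ dot); first exact: (generator_skew H_hilbert VU V0 xdom).
apply: (generator_sform_ge0 H_hilbert VU V0 VD D0 DD DZ DV DB xdom clx).
move=> y [ky [T yT]]; have [_ ->] := Dgen y T ky yT.
exact: (sform_C_alpha_ge0 H_hilbert piP alpha_smooth piU ky yT p0_proj zC).
Qed.
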